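(* Let $(G,\theta)$ be a compactification of $\mathbb{R}$ and let $h : G \to \mathbb{C}$ be a continuous function that is not identically zero and whose spectrum $\Omega(h)$ is bounded. Then $\log^{-}\circ|h| \in L^1(G)$, and consequently the Mahler measure of $h$ is positive: $M(h) > 0$.
   Context: A compactification of $\mathbb{R}$ is a pair $(G,\theta)$ where $G$ is a compact (Hausdorff) abelian group and $\theta : \mathbb{R}\to G$ is a continuous homomorphism with dense image. Integrals over $G$ and the spaces $L^p(G)$ are with respect to normalized Haar measure. $\widehat G$ is the Pontryagin dual of $G$, that is, the discrete group of continuous homomorphisms $\chi : G \to \mathbb{T} = \{z\in\mathbb{C}:|z|=1\}$. The map $\xi:\widehat G \to \mathbb{R}$, where $\xi(\chi)=\omega$ is the real number with $\chi(\theta(x)) = e^{i\omega x}$ for all $x\in\mathbb{R}$, is an injective homomorphism, by which $\widehat G$ is identified with a subset of $\mathbb{R}$. For $h \in L^1(G)$ the Fourier transform is $\mathfrak{F}(h)(\chi) = \int_G h\,\overline{\chi}$ and the spectrum is $\Omega(h) = \{\chi\in\widehat G : \mathfrak{F}(h)(\chi)\neq 0\}$, regarded as a subset of $\mathbb{R}$ via $\xi$; bounded means bounded as a subset of $\mathbb{R}$. For $x \ge 0$, $\log^{-}(x) = \log(\min\{1,x\}) \in [-\infty,0]$. The Mahler measure of $h$ is $M(h) = \exp\left(\int_G \log\circ|h|\right) \in [0,\infty)$, with $\log 0 = -\infty$ and $\exp(-\infty) = 0$. *)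

(* Defs.v *)
From HB Require Import structures.
From mathcomp Require Import all_boot all_order all_algebra.
From mathcomp Require Import all_classical all_reals all_analysis.
From mathcomp Require Import complex.

Set Implicit Arguments.
Unset Strict Implicit.
Unset Printing Implicit Defensive.

Import Order.TTheory GRing.Theory Num.Theory.
Import numFieldNormedType.Exports.

Local Open Scope classical_set_scope.
Local Open Scope ring_scope.

(* The usual topology of the complex numbers, given by the modulus: *)
(* the balls are {w | `|z - w| < e}, e a positive real.             *)
HB.instance Definition _ (R : realType) := NormedModule.copy R[i] (R[i]^o).

(* g_sigma_algebraType is only a measurableType over a pointed type. *)
#[non_forgetful_inheritance]
HB.instance Definition _ (G : topologicalZmodType) := isPointed.Build G 0.

Notation borel G := (g_sigma_algebraType (@open G)).

Section compactification.
Context {R : realType} {G : topologicalZmodType}.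

Definition compactification (theta : {additive R -> G}) : Prop :=
  [/\ compact [set: G], hausdorff_space G,
      continuous theta & dense (range theta)].

(* The normalized Haar measure on a compact group is the unique         *)
(* translation-invariant regular Borel probability measure. Regularity  *)
(* is not automatic: G, e.g. the Bohr compactification, need not be     *)
(* metrizable.                                                          *)
Definition haar (mu : probability (borel G) R) : Prop :=
  [/\ forall (a : G) (A : set (borel G)), measurable A ->
        mu [set a + x | x in (A : set G)] = mu A,
      forall A : set (borel G), measurable A ->
        mu A = ereal_inf [set mu U | U in [set U : set G | open U /\ A `<=` U]]
    & forall U : set G, open U ->
        mu U = ereal_sup [set mu K | K in [set K : set G | compact K /\ K `<=` U]]].

Definition dual : set (G -> R[i]) :=
  [set chi : G -> R[i] | [/\ continuous chi, {morph chi : x y / x + y >-> x * y}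
               & forall x, `|chi x| = 1]].

Definition expi (t : R) : R[i] := (cos t +i* sin t)%C.

(* The real number w such that chi (theta x) = e^{iwx} for all x; for    *)
(* chi in the dual of a compactification it exists and is unique, so the *)
(* default value 0 is not used.                                          *)
Definition xi (theta : {additive R -> G}) (chi : G -> R[i]) : R :=
  xget 0 [set w : R | forall x : R, chi (theta x) = expi (w * x)].

Definition Cintegral (mu : probability (borel G) R) (f : G -> R[i]) : R[i] :=
  ((\int[mu]_x complex.Re (f x)) +i* (\int[mu]_x complex.Im (f x)))%C.

Definition fourier (mu : probability (borel G) R) (h chi : G -> R[i]) : R[i] :=
  Cintegral mu (fun x => h x * ((chi x)^*)%C).

Definition spectrum (mu : probability (borel G) R) (h : G -> R[i]) :
    set (G -> R[i]) :=
  [set chi | dual chi /\ fourier mu h chi != 0].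

(* lne is the extended logarithm, with lne 0 = -oo. *)
Definition logminus (x : R) : \bar R := lne (Num.min 1 x)%:E.

(* For bounded h, the positive part of log |h| has a finite integral, so *)
(* the integral below is never the indeterminate +oo - oo.               *)
Definition mahler (mu : probability (borel G) R) (h : G -> R[i]) : \bar R :=
  expeR (\int[mu]_x lne (Normc.normc (h x))%:E)%E.

End compactification.

(* Main.v *)
Require Import Defs.
From HB Require Import structures.
From mathcomp Require Import all_boot all_order all_algebra.
From mathcomp Require Import all_classical all_reals all_analysis.
From mathcomp Require Import complex.
From mathcomp Require Import measurable_realfun ring lra zify.
Import Order.TTheory GRing.Theory Num.Theory.
Import numFieldNormedType.Exports.
Local Open Scope classical_set_scope.
Local Open Scope ring_scope.

(* On the line x + theta(R), h restricts to a function with bounded spectrum.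
   Convolving with the coefficients of a triangle wave gives a bounded operator D
   on C(G) whose multiplier is i w for all w in the spectrum of h; by uniqueness of
   Fourier coefficients exp(t D) h = h(. + theta t), so h is smooth along theta,
   with derivatives D^n h growing at most geometrically. If all of them vanish
   at x, then h vanishes on x + theta(R), hence on G by density; compactness then
   gives N and c > 0 such that everywhere some derivative of order at most N is at
   least c. By the mean value theorem, among K equally spaced points of a
   short segment x + theta([0, delta]) fewer than 2^N satisfy |h| <= e as soon as e is
   a small multiple of K^-N. Averaging over x yields mu(|h| <= c' K^-N) <= 2^N / K,
   and summing over K = 2^k shows that log^-|h| is integrable.

   Uniqueness of Fourier coefficients is proved for real functions, by the power
   method: the normalized powers of f * f~ converge to a convolution
   idempotent, a minimal idempotent below it satisfies d'Alembert's equation,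
   and the solutions of that equation are real parts of characters. *)

(** The image of [theta] can be a null set of G, so information on a single line says nothing about
    [mu]. Translation invariance supplies the link: a count of points, uniform over all short
    segments, integrates to a bound on a measure. The multiplier i w is unbounded and has to be
    matched only on the bounded spectrum. A periodic function that is linear near 0 and has
    absolutely summable Fourier coefficients does this with translations alone, which is why D is
    bounded in the sup norm. The bound on the spectrum is symmetric under w -> -w, so it passes from
    h to its real and imaginary parts. For real functions, convolution with an even function is
    self-adjoint, which is what the power method uses. The exponent N is harmless: a polynomial rate
    at e = c / 2^(kN) costs the logarithm only a factor proportional to k N, against measures that
    decay like 2^-k. *)

(** * Real variable lemmas *)

(** Log-convexity makes the ratios [a n.+1 / a n] nondecreasing and submultiplicativity bounds them
    by [a 0]; [l] is their limit. Comparing [r m ^+ n.+1 * a m <= a (m + n.+1) <= a n * a m] and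
    letting m grow gives the lower bound. In [power_method] this makes [a n / l ^+ n.+1]
    nonincreasing and at least 1. *)
Lemma ratio_limit (R : realType) (a : nat -> R) :
  (forall n, 0 < a n) -> (forall n, a n.+1 ^+ 2 <= a n * a n.+2) ->
  (forall n m, a (n + m).+1 <= a n * a m) ->
  exists l, [/\ 0 < l, forall n, l ^+ n.+1 <= a n & forall n, a n.+1 <= l * a n].
Proof.
move=> a0 aL aS.
pose r n := a n.+1 / a n.
have r0 n : 0 < r n by rewrite divr_gt0.
have rS n : r n <= r n.+1.
  by rewrite /r ler_pdivlMr// mulrAC ler_pdivrMr// -expr2 (le_trans (aL n))// mulrC.
have rM : {homo r : n m / (n <= m)%N >-> n <= m} by apply/nondecreasing_seqP.
have rB n : r n <= a 0%N.
  by rewrite /r ler_pdivrMr// mulrC; have := aS n 0%N; rewrite addn0.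
have rC : r @ \oo --> sup (range r).
  by apply: nondecreasing_cvgn => //; exists (a 0%N) => _ [n _ <-].
have rsup n : r n <= sup (range r).
  apply: ub_le_sup; last by exists n.
  by exists (a 0%N) => _ [k _ <-].
exists (sup (range r)); split.
- exact: lt_le_trans (r0 0%N) (rsup _).
- move=> n.
  have cX : (fun m => r m ^+ n.+1) @ \oo --> sup (range r) ^+ n.+1.
    exact: (cvg_comp _ _ rC (@exprn_continuous R n.+1 _)).
  apply: (cvgr_to_le cX); apply: nearW => m.
  have H k : r m ^+ k * a m <= a (m + k)%N.
    elim: k => [|k IH]; first by rewrite expr0 mul1r addn0.
    rewrite exprS -mulrA (le_trans (ler_wpM2l (ltW (r0 m)) IH))//.
    have rE : a (m + k).+1 = r (m + k)%N * a (m + k)%N by rewrite /r divfK// lt0r_neq0.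
    by rewrite addnS rE ler_pM2r// rM// leq_addr.
  rewrite -(ler_pM2r (a0 m)) (le_trans (H _))// addnS mulrC; exact: aS.
- by move=> n; rewrite -ler_pdivrMr//; exact: rsup.
Qed.

(** * Fourier series of the triangle wave *)

Section triangle_wave.
Context {R : realType}.
Implicit Types x y : R.

Lemma mvt_bound (f df : R -> R) (r C : R) :
  (forall y, `|y| <= r -> is_derive y 1 f (df y)) ->
  (forall y, `|y| <= r -> `|df y| <= C) ->
  forall x y, `|x| <= r -> `|y| <= r -> `|f y - f x| <= C * `|y - x|.
Proof.
move=> fD dfC.
have main x y : x <= y -> `|x| <= r -> `|y| <= r -> `|f y - f x| <= C * `|y - x|.
  move=> xy xr yr.
  have inr z : x <= z -> z <= y -> `|z| <= r.
    move=> xz zy; move: xr yr; rewrite !ler_norml => /andP[a1 a2] /andP[b1 b2].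
    by rewrite (le_trans a1 xz) (le_trans zy b2).
  have [||z zxy ->] := @MVT_segment R f df x y xy.
  - by move=> z; rewrite in_itv/= => /andP[/ltW xz /ltW zy]; apply: fD; exact: inr.
  - apply: derivable_within_continuous => z; rewrite in_itv/= => /andP[xz zy].
    by have [] := fD z (inr _ xz zy).
  - rewrite normrM ler_wpM2r//; apply: dfC; move: zxy; rewrite in_itv/= => /andP[xz zy].
    exact: inr.
move=> x y xr yr; case: (leP x y) => [xy|/ltW yx]; first exact: main.
by rewrite distrC [`|y - x|]distrC; exact: main.
Qed.

Lemma cos_ge_half y : `|y| <= 1 / 2 -> 1 / 2 <= cos y.
Proof.
move=> yr.
have cD (z : R) : `|z| <= 1 / 2 -> is_derive z 1 (cos : R -> R) (- sin z) by move=> _; exact: is_derive_cos.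
have sB (z : R) : `|z| <= 1 / 2 -> `|- sin z| <= 1 :> R.
  by move=> _; rewrite normrN ler_norml sin_geN1 sin_le1.
have z0 : `|0 : R| <= 1 / 2 by rewrite normr0; lra.
have := mvt_bound cos _ (1 / 2) 1 cD sB 0 y z0 yr.
rewrite cos0 subr0 mul1r => /le_trans/(_ yr).
by rewrite ler_norml => /andP[]; lra.
Qed.

Definition odd_nat k : R := (2 * k + 1)%:R.
Definition wave_coef k : R := (-1) ^+ k / odd_nat k ^+ 2.
(** The full series equals pi x / 4 for |x| <= pi / 2; its termwise derivative [wave_deriv] is the
    series of a square wave, constant near 0. *)
Definition wave_sum K x : R := \sum_(k < K) wave_coef k * sin (odd_nat k * x).
Definition wave_deriv K x : R := \sum_(k < K) (-1) ^+ k / odd_nat k * cos (odd_nat k * x).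

Lemma odd_nat_gt0 k : 0 < odd_nat k.
Proof. by rewrite ltr0n addn1. Qed.

Lemma odd_natS k : odd_nat k.+1 = odd_nat k + 2.
Proof. by rewrite /odd_nat -natrD; congr _%:R; lia. Qed.

Lemma odd_natE k : odd_nat k = 2 * k%:R + 1.
Proof. by rewrite /odd_nat natrD natrM. Qed.

Lemma is_derive_mull (o x : R) : is_derive x 1 (fun y => o * y) o.
Proof. by apply: is_derive_eq; rewrite /GRing.scale/= mulr1. Qed.

Lemma is_derive_sinl (o x : R) : is_derive x 1 (fun y => sin (o * y)) (cos (o * x) * o).
Proof. exact: (is_derive1_comp (is_derive_sin _) (is_derive_mull o x)). Qed.

Lemma is_derive_cosl (o x : R) : is_derive x 1 (fun y => cos (o * y)) (- sin (o * x) * o).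
Proof. exact: (is_derive1_comp (is_derive_cos _) (is_derive_mull o x)). Qed.

Lemma is_derive_wave_sum K x : is_derive x 1 (wave_sum K) (wave_deriv K x).
Proof.
elim: K => [|K IH].
  have -> : wave_sum 0 = fun=> 0 by apply/funext => z; rewrite /wave_sum big_ord0.
  by rewrite /wave_deriv big_ord0; exact: is_derive_cst.
have -> : wave_sum K.+1 = wave_sum K + wave_coef K \*: (fun y => sin (odd_nat K * y)).
  by apply/funext => z; rewrite /wave_sum big_ord_recr.
have -> : wave_deriv K.+1 x = wave_deriv K x + wave_coef K *: (cos (odd_nat K * x) * odd_nat K).
  rewrite /wave_deriv big_ord_recr/= /wave_coef /GRing.scale/=; congr (_ + _); field.
  by rewrite gt_eqF// odd_nat_gt0.
by apply: is_deriveD; apply: is_deriveZ; exact: is_derive_sinl.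
Qed.

Lemma is_derive_wave_deriv K x : is_derive x 1 (wave_deriv K)
  (- \sum_(k < K) (-1) ^+ k * sin (odd_nat k * x)).
Proof.
elim: K => [|K IH].
  have -> : wave_deriv 0 = fun=> 0 by apply/funext => z; rewrite /wave_deriv big_ord0.
  by rewrite big_ord0 oppr0; exact: is_derive_cst.
have -> : wave_deriv K.+1 = wave_deriv K + ((-1) ^+ K / odd_nat K) \*: (fun y => cos (odd_nat K * y)).
  by apply/funext => z; rewrite /wave_deriv big_ord_recr.
rewrite big_ord_recr/= opprD.
have -> : - ((-1) ^+ K * sin (odd_nat K * x)) =
  ((-1) ^+ K / odd_nat K) *: (- sin (odd_nat K * x) * odd_nat K).
  by rewrite /GRing.scale/=; field; rewrite gt_eqF// odd_nat_gt0.
by apply: is_deriveD; apply: is_deriveZ; exact: is_derive_cosl.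
Qed.

(** Since 2 cos y sin((2k+1) y) = sin((2k+2) y) + sin(2k y), the alternating sum telescopes. *)
Lemma sum_sin_odd K y :
  2 * cos y * (\sum_(k < K) (-1) ^+ k * sin (odd_nat k * y)) =
  - (-1) ^+ K * sin (2 * K%:R * y).
Proof.
elim: K => [|K IH]; first by rewrite big_ord0 !mulr0 mul0r sin0 mulr0.
rewrite big_ord_recr/= mulrDr IH exprS.
have -> : 2 * K.+1%:R * y = odd_nat K * y + y by rewrite odd_natE -natr1; ring.
have -> : 2 * K%:R * y = odd_nat K * y - y by rewrite odd_natE; ring.
by rewrite sinB sinD; ring.
Qed.

(** By [sum_sin_odd] the derivative of [wave_deriv K] is (-1)^K sin(2Ky) / (2 cos y), which is
    bounded but oscillates fast. One integration by parts gains the factor 1/K: adding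
    [(-1) ^+ K * v] cancels this term and leaves a derivative of size at most 1/K. The range |x| <=
    1/2 keeps cos y at least 1/2. *)
Lemma wave_deriv_flat K x : (0 < K)%N -> `|x| <= 1 / 2 ->
  `|wave_deriv K x - wave_deriv K 0| <= 2 / K%:R.
Proof.
move=> K0 xr.
have KR0 : 0 < K%:R :> R by rewrite ltr0n.
have KN : K%:R != 0 :> R by rewrite gt_eqF.
pose v y : R := cos (2 * K%:R * y) / (4 * K%:R * cos y).
pose Q y := wave_deriv K y + (-1) ^+ K * v y.
pose dQ y : R := (-1) ^+ K * (cos (2 * K%:R * y) * sin y / (4 * K%:R * cos y ^+ 2)).
have cn y : `|y| <= 1 / 2 -> cos y != 0.
  by move=> /cos_ge_half cy; rewrite gt_eqF//; lra.
have c1 y : `|cos y| <= 1 :> R by rewrite ler_norml cos_geN1 cos_le1.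
have s1 y : `|sin y| <= 1 :> R by rewrite ler_norml sin_geN1 sin_le1.
have sg k : `|(-1) ^+ k| = 1 :> R by rewrite normrX normrN1 expr1n.
have QD y : `|y| <= 1 / 2 -> is_derive y 1 Q (dQ y).
  move=> /cn cy.
  have E : - \sum_(k < K) (-1) ^+ k * sin (odd_nat k * y) =
      (-1) ^+ K * sin (2 * K%:R * y) / (2 * cos y).
    have -> : (-1) ^+ K * sin (2 * K%:R * y) = - (2 * cos y * \sum_(k < K) (-1) ^+ k * sin (odd_nat k * y)).
      by rewrite sum_sin_odd; ring.
    by field.
  have -> : dQ y = - (\sum_(k < K) (-1) ^+ k * sin (odd_nat k * y)) + (-1) ^+ K *:
      (cos (2 * K%:R * y) *: (- (4 * K%:R * cos y) ^- 2 *: (4 * K%:R *: (- sin y)))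
        + (4 * K%:R * cos y)^-1 *: (- sin (2 * K%:R * y) * (2 * K%:R))).
    rewrite E /dQ /GRing.scale/=; field.
    by rewrite cy KN.
  have cV : is_derive y 1 (fun z => (4 * K%:R * cos z)^-1)
      (- (4 * K%:R * cos y) ^- 2 *: (4 * K%:R *: (- sin y))).
    by apply: (is_deriveV (f := fun z => 4 * K%:R * cos z)); rewrite !mulf_neq0.
  apply: (is_deriveD (is_derive_wave_deriv K y)).
  exact: (is_deriveZ _ (is_deriveM (is_derive_cosl _ y) cV)).
have dQb y : `|y| <= 1 / 2 -> `|dQ y| <= 1 / K%:R.
  move=> yr; have cy := cos_ge_half y yr.
  rewrite /dQ normrM sg !mul1r !normrM normfV normrM.
  rewrite (ger0_norm (_ : 0 <= 4 * K%:R)) ?mulr_ge0//.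
  rewrite (ger0_norm (_ : 0 <= cos y ^+ 2)) ?sqr_ge0//.
  have h4 : K%:R <= 4 * K%:R * cos y ^+ 2.
    have : 1 / 4 <= cos y ^+ 2 by nra.
    by nra.
  rewrite ler_pdivrMr; last exact: lt_le_trans KR0 h4.
  apply: (@le_trans _ _ 1); first by rewrite mulr_ile1.
  by rewrite mulrC ler_pdivlMr// ?mul1r; lra.
have vb y : `|y| <= 1 / 2 -> `|(-1) ^+ K * v y| <= 1 / (2 * K%:R).
  move=> yr; have cy := cos_ge_half y yr.
  rewrite /v normrM sg !mul1r normrM normfV normrM.
  rewrite (ger0_norm (_ : 0 <= 4 * K%:R)) ?mulr_ge0//.
  rewrite (ger0_norm (_ : 0 <= cos y)); last by lra.
  have h4 : 2 * K%:R <= 4 * K%:R * cos y by nra.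
  rewrite ler_pdivrMr; last by lra.
  apply: (le_trans (c1 _)).
  by rewrite mulrC ler_pdivlMr ?mul1r; lra.
have z0 : `|0 : R| <= 1 / 2 by rewrite normr0; lra.
have := mvt_bound Q dQ (1 / 2) (1 / K%:R) QD dQb 0 x z0 xr.
rewrite subr0 => H1.
have H2 := vb x xr; have H3 := vb 0 z0.
have -> : wave_deriv K x - wave_deriv K 0 =
  (Q x - Q 0) - (-1) ^+ K * v x + (-1) ^+ K * v 0 by rewrite /Q; ring.
rewrite (le_trans (ler_normD _ _))//.
have -> : 2 / K%:R = 1 / K%:R + 1 / (2 * K%:R) + 1 / (2 * K%:R) :> R by field.
rewrite lerD// (le_trans (ler_normB _ _))// lerD// (le_trans H1)//.
by rewrite ler_piMr// ?divr_ge0//; lra.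
Qed.

Lemma wave_sum_linear K x : (0 < K)%N -> `|x| <= 1 / 2 ->
  `|wave_sum K x - x * wave_deriv K 0| <= 2 / K%:R.
Proof.
move=> K0 xr.
have z0 : `|0 : R| <= 1 / 2 by rewrite normr0; lra.
have KR0 : 0 < K%:R :> R by rewrite ltr0n.
have D y : is_derive y 1 (fun z => wave_sum K z - wave_deriv K 0 * z) (wave_deriv K y - wave_deriv K 0).
  exact: (is_deriveB (is_derive_wave_sum K y) (is_derive_mull _ y)).
have := mvt_bound _ _ (1 / 2) (2 / K%:R) (fun y _ => D y)
  (fun y => wave_deriv_flat K y K0) 0 x z0 xr.
have -> : wave_sum K 0 = 0.
  by rewrite /wave_sum big1// => i _; rewrite mulr0 sin0 mulr0.
rewrite mulr0 !subr0 mulrC => /le_trans; apply.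
by rewrite ler_piMr// ?divr_ge0// ?ltW//; lra.
Qed.

(** With o = [odd_nat k] >= 1, 1 / o^2 <= 3 / (o (o + 2)) = 3/2 (1/o - 1/(o + 2)), which
    telescopes. *)
Lemma wave_coef_tail n m : (n <= m)%N ->
  \sum_(n <= k < m) `|wave_coef k| <= 3 / 2 * (odd_nat n)^-1.
Proof.
move=> nm.
suff : \sum_(n <= k < m) `|wave_coef k| <= 3 / 2 * ((odd_nat n)^-1 - (odd_nat m)^-1).
  have : 0 < (odd_nat m)^-1 by rewrite invr_gt0 odd_nat_gt0.
  by lra.
elim: m nm => [|m IH].
  by rewrite leqn0 => /eqP ->; rewrite big_geq// subrr mulr0.
rewrite leq_eqVlt => /predU1P[->|]; first by rewrite big_geq// subrr mulr0.
rewrite ltnS => nm; rewrite big_nat_recr//=.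
have o0 := odd_nat_gt0 m.
have o1 : 1 <= odd_nat m by rewrite odd_natE; have : 0 <= m%:R :> R by []; lra.
suff : `|wave_coef m| <= 3 / 2 * ((odd_nat m)^-1 - (odd_nat m.+1)^-1).
  by have := IH nm; lra.
rewrite /wave_coef normrM normrX normrN1 expr1n mul1r normfV.
rewrite (ger0_norm (_ : 0 <= odd_nat m ^+ 2)) ?sqr_ge0// odd_natS.
have -> : 3 / 2 * ((odd_nat m)^-1 - (odd_nat m + 2)^-1) = 3 * (odd_nat m * (odd_nat m + 2))^-1.
  by field; rewrite !gt_eqF//; lra.
rewrite -[3 * _]/(3 / _) ler_pdivlMr; last by nra.
rewrite mulrC ler_pdivrMr; last by nra.
by nra.
Qed.

(** Even partial sums of the Leibniz series increase from 1 - 1/3; this keeps the limiting slope L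
    away from 0. *)
Lemma wave_deriv_even_ge m : 2 / 3 <= wave_deriv (2 * m.+1) 0.
Proof.
elim: m => [|m IH].
  have o0 : odd_nat 0 = 1 by [].
  have o1 : odd_nat 1 = 3 by [].
  rewrite -[(2 * 1)%N]/2%N /wave_deriv !big_ord_recr/= big_ord0 !mulr0 cos0 o0 o1.
  by rewrite expr0 expr1; lra.
rewrite (_ : (2 * m.+2 = (2 * m.+1).+2)%N); last by lia.
rewrite /wave_deriv 2!big_ord_recr/= -/(wave_deriv _ _) !mulr0 cos0 !mulr1.
have o0 := odd_nat_gt0 (2 * m.+1).
have sg : (-1) ^+ (2 * m.+1) = 1 :> R by rewrite exprM sqrrN !expr1n.
rewrite exprS sg mulr1 odd_natS.
have : (odd_nat (2 * m.+1) + 2)^-1 <= (odd_nat (2 * m.+1))^-1.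
  by rewrite lef_pV2 ?posrE//; lra.
by lra.
Qed.

(* The Fourier series of the triangle wave; the value of L is pi / 4. *)
Lemma triangle_wave : exists2 L : R, L != 0 & forall x, `|x| <= 1 / 2 ->
  wave_sum K x @[K --> \oo] --> L * x.
Proof.
have Kinv (e : R) : 0 < e -> \forall K \near \oo, (0 < K)%N /\ 2 / K%:R <= e.
  move=> e0; exists (Num.truncn (2 / e)).+1 => // K /= NK; split; first exact: leq_trans NK.
  have h0 : 0 <= 2 / e by rewrite divr_ge0// ltW.
  have /andP[_ h] := truncn_itv h0.
  have K0 : 0 < K%:R :> R by rewrite ltr0n (leq_trans _ NK).
  rewrite ler_pdivrMr// mulrC -ler_pdivrMr// (le_trans (ltW h))// ler_nat//.
have hh : `|1 / 2 : R| <= 1 / 2 by rewrite ger0_norm; lra.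
have cS : cvgn (fun K => wave_sum K (1 / 2)).
  have -> : (fun K => wave_sum K (1 / 2)) = series (fun k => wave_coef k * sin (odd_nat k * (1 / 2))).
    by apply/funext => K; rewrite /series/= big_mkord.
  apply: normed_cvg; apply: (@series_le_cvg _ _ (fun k => `|wave_coef k|)) => [k|k|k|]; [exact: normr_ge0|exact: normr_ge0| |].
    by rewrite /= normrM ler_piMr// ler_norml sin_geN1 sin_le1.
  apply: nondecreasing_is_cvgn; first exact: nondecreasing_series.
  by exists (3 / 2 * (odd_nat 0)^-1) => _ [K _ <-]; exact: wave_coef_tail.
(* The slope is read off from the value at 1/2, where the series converges absolutely; the Leibniz
   series for [wave_deriv K 0] then converges to it by [wave_sum_linear]. *)
pose L : R := 2 * limn (fun K => wave_sum K (1 / 2)).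
have PL : wave_deriv K 0 @[K --> \oo] --> L.
  apply/cvgrPdist_le => e e0.
  have e40 : 0 < e / 4 by rewrite divr_gt0.
  have /cvgrPdist_le/(_ _ e40) H1 := cS.
  near=> K.
  have [K0 Ke] : (0 < K)%N /\ 2 / K%:R <= e / 4 by near: K; exact: Kinv.
  have h1 : `|limn (fun K => wave_sum K (1 / 2)) - wave_sum K (1 / 2)| <= e / 4 by near: K.
  have h2 := wave_sum_linear K (1 / 2) K0 hh.
  have h3 := le_trans h2 Ke.
  move: h1 h3; rewrite /L !ler_norml => /andP[? ?] /andP[? ?]; apply/andP; split; lra.
exists L.
  rewrite gt_eqF//.
  have /cvgrPdist_le/(_ (1 / 3)) := PL; case; first by lra.
  move=> N _ /(_ (2 * N.+1)%N) /=.
  have := wave_deriv_even_ge N.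
  move=> h1 /(_ _)/[!ler_norml] h2.
  have /andP[? ?] := h2 ltac:(lia); lra.
move=> x xr; apply/cvgrPdist_le => e e0.
have e20 : 0 < e / 2 by rewrite divr_gt0.
have /cvgrPdist_le/(_ _ e20) H1 := PL.
near=> K.
have [K0 Ke] : (0 < K)%N /\ 2 / K%:R <= e / 2 by near: K; exact: Kinv.
have h1 : `|L - wave_deriv K 0| <= e / 2 by near: K.
have h2 := le_trans (wave_sum_linear K x K0 xr) Ke.
have -> : L * x - wave_sum K x = (L - wave_deriv K 0) * x - (wave_sum K x - x * wave_deriv K 0) by ring.
rewrite (splitr e) (le_trans (ler_normB _ _))// lerD// normrM.
by rewrite (le_trans _ h1)// ler_piMr//; lra.
Unshelve. all: end_near. Qed.

End triangle_wave.

(** * Continuous characters of the real line *)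

Section real_character.
Context {R : realType}.

(** On some [0, r] the function c is positive, and al = asin (d r) is an angle for the value at r.
    The half-angle formulas determine the values at r / 2^n up to sign, and positivity of c fixes
    the sign. The addition formulas extend this to dyadic multiples of r, and continuity to t >= 0,
    with w = al / r; parity gives the rest. *)
Lemma real_character (c d : R -> R) : continuous c -> continuous d ->
  (forall x, c x ^+ 2 + d x ^+ 2 = 1) ->
  (forall x y, c (x + y) = c x * c y - d x * d y) ->
  (forall x y, d (x + y) = d x * c y + c x * d y) ->
  exists w, forall t, c t = cos (w * t) /\ d t = sin (w * t).
Proof.
move=> cc cd n1 cD dD.
have [c0 d0] : c 0 = 1 /\ d 0 = 0.
  have := n1 0; have := cD 0 0; have := dD 0 0; rewrite addr0 => E1 E2 E3.
  have /eqP : d 0 * (1 - 2 * c 0) = 0 by lra.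
  rewrite mulf_eq0 => /orP[/eqP dz|/eqP cz]; last by nra.
  by split=> //; rewrite dz in E2 E3; nra.
have cN t : c (- t) = c t /\ d (- t) = - d t.
  have := cD t (- t); have := dD t (- t); rewrite subrr c0 d0 => E1 E2.
  have := n1 t => E3.
  split.
    transitivity (c (- t) * (c t ^+ 2 + d t ^+ 2)); first by rewrite E3 mulr1.
    transitivity (c t * (c t * c (- t) - d t * d (- t)) + d t * (d t * c (- t) + c t * d (- t))).
      by ring.
    by rewrite -E1 -E2; ring.
  transitivity (d (- t) * (c t ^+ 2 + d t ^+ 2)); first by rewrite E3 mulr1.
  transitivity (c t * (d t * c (- t) + c t * d (- t)) - d t * (c t * c (- t) - d t * d (- t))).
    by ring.
  by rewrite -E1 -E2; ring.
have [r r0 rP] : exists2 r, 0 < r & forall t, 0 <= t <= r -> 0 < c t.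
  have /cvgrPdist_lt/(_ _ ltr01) := cc 0.
  rewrite c0 => /nbhs_ballP[e /= e0 He].
  exists (e / 2); first by rewrite divr_gt0.
  move=> t /andP[t0 te]; have := He t.
  rewrite /ball/= sub0r normrN ger0_norm// => /(_ _).
  rewrite ltr_norml => H; have /andP[] := H ltac:(lra); lra.
have d1 t : -1 <= d t <= 1.
  by rewrite -ler_norml -(@ler_pXn2r _ 2)// ?nnegrE// expr1n real_normK ?num_real//; have := n1 t; nra.
pose al := asin (d r).
have cal : 0 < cos al.
  have := rP r; rewrite lexx ltW// => /(_ isT) cr.
  by rewrite /al cos_asin// sqrtr_gt0; have := n1 r; nra.
have al_r : c r = cos al /\ d r = sin al.
  have := rP r; rewrite lexx ltW// => /(_ isT) cr.
  rewrite /al asinK ?in_itv/= ?d1// cos_asin//; split=> //.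
  have -> : 1 - d r ^+ 2 = c r ^+ 2 by rewrite -(n1 r) addrK.
  by rewrite sqrtr_sqr gtr0_norm.
have alb : - (pi / 2) <= al <= pi / 2.
  by rewrite /al asin_geNpi2// asin_lepi2.
have half (x : R) : cos x = 2 * cos (x / 2) ^+ 2 - 1 /\ sin x = 2 * (sin (x / 2) * cos (x / 2)).
  have E : x = x / 2 + x / 2 by rewrite -splitr.
  split; rewrite {1}E ?cosD ?sinD; last by ring.
  by have := cos2Dsin2 (x / 2); lra.
have p2 n : 0 < 2 ^+ n :> R by rewrite exprn_gt0.
have p2' n : 1 <= 2 ^+ n :> R by rewrite exprn_ege1// ler1n.
have step n : c (r / 2 ^+ n) = cos (al / 2 ^+ n) /\ d (r / 2 ^+ n) = sin (al / 2 ^+ n).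
  elim: n => [|n [IHc IHd]]; first by rewrite expr0 !divr1.
  have E1 (x : R) : x / 2 ^+ n.+1 = x / 2 ^+ n / 2 by rewrite exprSr invfM mulrA.
  rewrite !E1; set s := r / 2 ^+ n in IHc IHd *; set b := al / 2 ^+ n in IHc IHd *.
  have s0 : 0 < s by rewrite divr_gt0.
  have sr : s <= r by rewrite /s ler_pdivrMr// ler_peMr// ltW.
  have cs : 0 < c (s / 2) by apply: rP; apply/andP; split; lra.
  have cb : 0 < cos (b / 2).
    apply: cos_gt0_pihalf.
    have bb : `|b| <= pi / 2.
      rewrite /b normrM normfV (gtr0_norm (p2 n)) ler_pdivrMr//.
      apply: (@le_trans _ _ (pi / 2)); first by rewrite ler_norml.
      by rewrite ler_peMr// divr_ge0// pi_ge0.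
    by move: bb; rewrite ler_norml => /andP[]; have := pi_gt0 R; move=> ? ? ?; apply/andP; split; lra.
  have [h1 h2] := half b.
  have e1 : c s = 2 * c (s / 2) ^+ 2 - 1.
    by rewrite {1}(splitr s) cD; have := n1 (s / 2); lra.
  have e2 : d s = 2 * (d (s / 2) * c (s / 2)) by rewrite {1}(splitr s) dD; ring.
  have ecos : c (s / 2) = cos (b / 2).
    apply/eqP; rewrite -(@eqrXn2 _ 2)// ?ltW//; apply/eqP; lra.
  split => //; apply: (mulIf (lt0r_neq0 cb)).
  by rewrite -{1}ecos; lra.
pose w := al / r.
have mult n m : c (m%:R * (r / 2 ^+ n)) = cos (w * (m%:R * (r / 2 ^+ n))) /\
    d (m%:R * (r / 2 ^+ n)) = sin (w * (m%:R * (r / 2 ^+ n))).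
  elim: m => [|m [IHc IHd]]; first by rewrite mul0r mulr0 cos0 sin0.
  have [s1 s2] := step n.
  have E : w * (r / 2 ^+ n) = al / 2 ^+ n by rewrite /w; field; rewrite !gt_eqF.
  rewrite -natr1 mulrDl mul1r cD dD mulrDr cosD sinD E.
  by rewrite IHc IHd s1 s2; split; ring.
have pos t : 0 <= t -> c t = cos (w * t) /\ d t = sin (w * t).
  move=> t0; pose s n := r / 2 ^+ n.
  pose u n := (Num.truncn (t / s n))%:R * s n.
  have s0 n : 0 < s n by rewrite divr_gt0.
  have ut : u @ \oo --> t.
    have s_cvg : s @ \oo --> 0.
      have := @cvg_geometric R r (1 / 2); rewrite ger0_norm; last by lra.
      move=> H; have -> : s = geometric r (1 / 2); last by apply: H; lra.
      by apply/funext => n; rewrite /s /geometric/= expr_div_n expr1n mul1r.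
    apply/cvgrPdist_le => e e0.
    have /cvgrPdist_le/(_ _ e0) := s_cvg; apply: filterS => n.
    rewrite sub0r normrN (gtr0_norm (s0 n)) => sne.
    have /andP[h1 h2] := truncn_itv (divr_ge0 t0 (ltW (s0 n))).
    rewrite ler_pdivlMr// in h1; rewrite ltr_pdivrMr// -natr1 mulrDl mul1r in h2.
    by rewrite /u ger0_norm; lra.
  have wc : (fun n => w * u n) @ \oo --> w * t by apply: cvgMr.
  split.
    apply: (@cvg_unique _ _ (c (u n) @[n --> \oo])) => //; first exact: (cvg_comp _ _ ut (cc t)).
    have -> : (fun n => c (u n)) = (fun n => cos (w * u n)).
      by apply/funext => n; have [] := mult n (Num.truncn (t / s n)).
    exact: (cvg_comp _ _ wc (@continuous_cos R _)).
  apply: (@cvg_unique _ _ (d (u n) @[n --> \oo])) => //; first exact: (cvg_comp _ _ ut (cd t)).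
  have -> : (fun n => d (u n)) = (fun n => sin (w * u n)).
    by apply/funext => n; have [] := mult n (Num.truncn (t / s n)).
  exact: (cvg_comp _ _ wc (@continuous_sin R _)).
exists w => t; have [/pos//|/ltW t0] := leP 0 t.
have [|e1 e2] := pos (- t); first by rewrite oppr_ge0.
have [f1 f2] := cN t; rewrite -f1 e1 mulrN cosN; split => //.
by rewrite -[LHS]opprK -f2 e2 mulrN sinN opprK.
Qed.

End real_character.

(** * Small values at sampled points *)

Section sublevel.
Context {R : realType}.

(* Points are consumed in pairs, so that the mean value points of consecutive
   pairs stay s-separated. *)
Lemma separated_small_values n (F : nat -> R -> R) (s e : R) (p : nat -> R) :
  0 < s -> (forall n (t : R), is_derive t 1 (F n) (F n.+1 t)) ->
  (forall i, (i.+1 < 2 ^ n)%N -> p i + s <= p i.+1) ->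
  (forall i, (i < 2 ^ n)%N -> `|F 0%N (p i)| <= e) ->
  exists y, [/\ p 0%N <= y, y <= p (2 ^ n).-1 & `|F n y| <= (2 / s) ^+ n * e].
Proof.
move=> s0; elim: n F e p => [|n IH] F e p FD ps pe.
  by exists (p 0%N); split; rewrite ?expn0 ?expr0 ?mul1r//; exact: pe.
have pair i : (i < 2 ^ n)%N -> exists y, [/\ p i.*2 <= y, y <= p i.*2.+1 & `|F 1%N y| <= 2 / s * e].
  move=> ni; have n2 : (i.*2.+1 < 2 ^ n.+1)%N by rewrite expnS; lia.
  have gap := ps _ n2; have ab : p i.*2 <= p i.*2.+1 by rewrite (le_trans _ gap)// lerDl ltW.
  have [|y yab E] := MVT_segment ab (fun z _ => FD 0%N z).
  - by apply: derivable_within_continuous => z _; have [] := FD 0%N z.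
  move: yab; rewrite in_itv/= => /andP[y1 y2]; exists y; split => //.
  have h1 := pe _ (ltnW n2); have h2 := pe _ n2.
  have h3 : `|F 1%N y| * (p i.*2.+1 - p i.*2) <= e + e.
    rewrite -(ger0_norm (_ : 0 <= p i.*2.+1 - p i.*2)) ?subr_ge0// -normrM -E.
    by rewrite (le_trans (ler_normB _ _))// lerD.
  rewrite -(ler_pM2r s0).
  have -> : 2 / s * e * s = e + e by field; rewrite gt_eqF.
  by apply: le_trans h3; rewrite ler_wpM2l// lerBrDl.
have /choice[q Hq] : forall i, exists y, (i < 2 ^ n)%N ->
    [/\ p i.*2 <= y, y <= p i.*2.+1 & `|F 1%N y| <= 2 / s * e].
  move=> i; case: (ltnP i (2 ^ n)) => [/pair[y Hy]|_]; first by exists y.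
  by exists 0.
have [|| y [y1 y2 y3]] := IH (fun n => F n.+1) (2 / s * e) q (fun k => FD k.+1).
- move=> i ni; have [_ a _] := Hq i (ltnW ni); have [b _ _] := Hq i.+1 ni.
  rewrite doubleS in b; apply: le_trans b.
  have := ps i.*2.+1; rewrite expnS => /(_ ltac:(lia)).
  by apply: le_trans; rewrite lerD2r.
- by move=> i /Hq[].
have n0 : (0 < 2 ^ n)%N by rewrite expn_gt0.
exists y; split.
- by have [a _ _] := Hq _ n0; exact: le_trans y1.
- have [|_ b _] := Hq (2 ^ n).-1; first by rewrite prednK.
  apply: (le_trans y2); apply: (le_trans b).
  rewrite (_ : (2 ^ n).-1.*2.+1 = (2 ^ n.+1).-1)//.
  by rewrite expnS; lia.
- by rewrite exprSr -mulrA.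
Qed.

(** If 2^n of the K samples had small values, they would be separated by dl / K, and
    [separated_small_values] would give a point of [0, dl] with [|F n| <= (2 K / dl)^n e < c]. *)
Lemma count_small_values n (F : nat -> R -> R) (K : nat) (dl e c : R) (P : pred nat) :
  (0 < K)%N -> 0 < dl ->
  (forall n (t : R), is_derive t 1 (F n) (F n.+1 t)) ->
  (forall t, 0 <= t <= dl -> c <= `|F n t|) ->
  (2 * K%:R / dl) ^+ n * e < c ->
  (forall j, P j -> `|F 0%N (j%:R * (dl / K%:R))| <= e) ->
  (count P (iota 0 K) < 2 ^ n)%N.
Proof.
move=> K0 dl0 FD Fc ec HP; rewrite ltnNge; apply/negP => big.
have KR : 0 < K%:R :> R by rewrite ltr0n.
pose J := [seq j <- iota 0 K | P j].
have szJ : size J = count P (iota 0 K) by rewrite size_filter.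
have s0 : 0 < dl / K%:R by rewrite divr_gt0.
have sJ : sorted ltn J by apply: sorted_filter; [exact: ltn_trans|exact: iota_ltn_sorted].
have memJ i : (i < 2 ^ n)%N -> P (nth 0%N J i) /\ (nth 0%N J i < K)%N.
  move=> ni; have : nth 0%N J i \in J by rewrite mem_nth// szJ (leq_trans ni).
  by rewrite mem_filter mem_iota add0n => /andP[? /andP[_ ?]].
pose p i := (nth 0%N J i)%:R * (dl / K%:R).
have [||y [y1 y2 y3]] := @separated_small_values n F (dl / K%:R) e p s0 FD.
- move=> i ni.
  have lt : (nth 0%N J i < nth 0%N J i.+1)%N.
    apply: (sorted_ltn_nth ltn_trans 0%N sJ) => //; rewrite inE szJ.
      by rewrite (leq_trans _ big)// ltnW.
    by rewrite (leq_trans _ big).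
  rewrite /p -[X in _ + X]mul1r -mulrDl ler_wpM2r ?(ltW s0)//.
  by rewrite natr1 ler_nat.
- by move=> i /memJ[+ _]; exact: HP.
have y0 : 0 <= y by apply: le_trans y1; rewrite /p mulr_ge0 ?(ltW s0).
have yd : y <= dl.
  apply: (le_trans y2); rewrite /p mulrA ler_pdivrMr// [leLHS]mulrC ler_wpM2l ?(ltW dl0)//.
  have [|_ h] := memJ (2 ^ n).-1; first by rewrite prednK// expn_gt0.
  by rewrite ler_nat ltnW.
have := Fc y; rewrite y0 yd => /(_ isT) h.
have := le_trans h y3; rewrite leNgt => /negP; apply.
by rewrite invf_div mulrA.
Qed.

End sublevel.

(** * Integrability of the logarithm from sublevel estimates *)

Section logminus.
Context {R : realType}.

Lemma measurable_lne_EFin : measurable_fun [set: R] (fun x : R => lne x%:E).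
Proof.
rewrite (_ : (fun x : R => lne x%:E) = (fun x => if x <= 0 then -oo%E else (ln x)%:E)); last first.
  by apply/funext.
apply: measurable_fun_ifT => //; first exact: measurable_fun_ler.
by apply/measurable_EFinP; exact: measurable_ln.
Qed.

Lemma logminus_le0 (x : R) : (logminus x <= 0)%E.
Proof. by rewrite /logminus lne_le0 lee_fin ge_min lexx. Qed.

Context {d} {T : measurableType d} (mu : probability T R).
Variable r : T -> R.
Hypothesis mr : measurable_fun [set: T] r.

Lemma measurable_logminus : measurable_fun [set: T] (fun x => logminus (r x)).
Proof.
apply: (measurableT_comp measurable_lne_EFin).
exact: measurable_minr.
Qed.

(** If k is least with x outside [E k], then r x > c / 2^(kN), so -log^- (r x) <= k N ln 2 + |ln c|,
    while x lies in the k sets [E j], j < k. Hence -log^- r is at most |ln c| plus a multiple of the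
    sum of the indicators of the [E k], whose integrals decay like 2^N / 2^k. *)
Lemma logminus_integrable (N : nat) (c : R) : 0 < c ->
  (forall K, (0 < K)%N -> (K%:R%:E * mu [set x | (r x <= c / K%:R ^+ N)%R] <= (2 ^ N)%:R%:E)%E) ->
  mu.-integrable [set: T] (fun x => logminus (r x)).
Proof.
move=> c0 Hmu.
pose E k := [set x | r x <= c / (2 ^ k)%:R ^+ N].
have mE k : measurable (E k).
  by rewrite -[E k]setTI; apply: measurable_fun_ler => //.
(* The summand 1 keeps [a >= 1] also for N = 0, so that the series below is infinite at points lying
   in every [E k], where log^- may be -oo. *)
pose a : R := N%:R * ln 2 + 1; pose b : R := `|ln c|.
have ln2 : 0 <= ln 2 :> R by rewrite ln_ge0// ler1n.
have a1 : 1 <= a by rewrite /a lerDr mulr_ge0.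
have a0 : 0 <= a by exact: le_trans a1.
pose phi k x := (a * \1_(E k) x)%:E.
have phi0 k x : (0 <= phi k x)%E by rewrite lee_fin mulr_ge0.
have mphi k : measurable_fun [set: T] (phi k).
  by apply/measurable_EFinP; apply: measurable_funM => //; exact: measurable_indic.
have muE k : (mu (E k) <= (2 ^+ N / 2 ^+ k)%:E)%E.
  have k2 : (0 < 2 ^ k)%N by rewrite expn_gt0.
  have := Hmu _ k2; rewrite -/(E k) -(fineK (fin_num_measure mu _ (mE k))) -EFinM !lee_fin.
  by rewrite !natrX mulrC ler_pdivlMr// exprn_gt0.
have part k x n : (forall j, (j < n)%N -> E j x) -> (n <= k)%N -> ((n%:R * a)%:E <= \sum_(0 <= j < k) phi j x)%E.
  move=> Ex nk; apply: (@le_trans _ _ (\sum_(0 <= j < n) phi j x)%E).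
    rewrite (eq_big_nat _ _ (F2 := fun=> a%:E)); last first.
      by move=> j /andP[_ /Ex jn]; rewrite /phi indicE mem_set// mulr1.
    by rewrite sumEFin big_const_nat subn0 iter_addr_0 mulr_natl.
  by rewrite (big_cat_nat (leq0n n) nk)/= leeDl// sume_ge0.
have ser n x : (\sum_(0 <= j < n) phi j x <= \sum_(0 <= j <oo) phi j x)%E.
  exact: nneseries_lim_ge.
have bound x : (- logminus (r x) <= \sum_(0 <= k <oo) phi k x + b%:E)%E.
  have [Hall|/existsNP] := pselect (forall k, E k x).
    suff -> : (\sum_(0 <= k <oo) phi k x = +oo)%E by rewrite addye// leey.
    apply/eq_infty => t.
    pose n := (Num.truncn `|t|).+1.
    apply: le_trans (ser n x); apply: le_trans (part n x n (fun j _ => Hall j) (leqnn _)).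
    rewrite lee_fin (le_trans (ler_norm t))//.
    have /andP[_ h] := truncn_itv (normr_ge0 t).
    by rewrite (le_trans (ltW h))// -[leLHS]mulr1 ler_wpM2l.
  move=> [k0 nE0].
  have ex : exists k, `[< ~ E k x >] by exists k0; apply/asboolP.
  case: (ex_minnP ex) => k /asboolP nEk kmin.
  have Ej j : (j < k)%N -> E j x.
    move=> jk; apply: contrapT => nEj; have := kmin j; rewrite leqNgt jk => /(_ _).
    by move=> h; have := h (introT (asboolP _) nEj).
  have h1 := le_trans (part k x k Ej (leqnn _)) (ser k x).
  apply: (@le_trans _ _ ((k%:R * a)%:E + b%:E)%E); last by rewrite leeD2r.
  have p2 : 0 < (2 ^ k)%:R ^+ N :> R by rewrite exprn_gt0// ltr0n expn_gt0.
  have e0 : 0 < c / (2 ^ k)%:R ^+ N by rewrite divr_gt0.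
  have re : c / (2 ^ k)%:R ^+ N < r x by rewrite ltNge; apply/negP.
  have r0 : 0 < r x by exact: lt_trans re.
  have m0 : 0 < Num.min 1 (r x) by rewrite lt_min ltr01.
  rewrite /logminus lne_EFin// -EFinN -EFinD lee_fin.
  have ka : 0 <= k%:R * a by rewrite mulr_ge0.
  have b0 : 0 <= b by exact: normr_ge0.
  case: (leP 1 (r x)) => r1; first by rewrite ln1 oppr0 addr_ge0.
  have : ln (c / (2 ^ k)%:R ^+ N) <= ln (r x) by rewrite ler_ln// ltW.
  rewrite ln_div ?posrE// lnXn ?ltr0n ?expn_gt0// natrX lnXn//.
  have -> : ln 2 *+ k *+ N = k%:R * (N%:R * ln 2) :> R.
    by rewrite -(mulr_natl (ln 2)) -mulr_natl; ring.
  have := ler_norm (- ln c); rewrite normrN -/b => ? ?.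
  have k00 : 0 <= k%:R :> R by [].
  by rewrite /a mulrDr mulr1; lra.
apply/integrableP; split; first exact: measurable_logminus.
have absE x : `|logminus (r x)|%E = (- logminus (r x))%E.
  by rewrite lee0_abs// logminus_le0.
under eq_integral do rewrite absE.
have mser : measurable_fun [set: T] (fun x => \sum_(0 <= k <oo) phi k x)%E.
  by apply: ge0_emeasurable_sum.
apply: (@le_lt_trans _ _ (\int[mu]_x (\sum_(0 <= k <oo) phi k x + b%:E))%E).
  apply: ge0_le_integral => //.
  - by move=> x _; rewrite oppe_ge0 logminus_le0.
  - by apply: measurableT_comp => //; exact: measurable_logminus.
  - by apply: emeasurable_funD.
rewrite ge0_integralD//; last 2 first.
  - by move=> x _; rewrite nneseries_ge0.
  - by move=> x _; rewrite lee_fin; exact: normr_ge0.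
rewrite integral_cst// integral_nneseries//.
apply: lte_add_pinfty; last first.
  by rewrite [X in (_ * X)%E](_ : _ = 1%E) ?mule1 ?ltry//; exact: probability_setT.
apply: (@le_lt_trans _ _ (a * 2 ^+ N * 2)%:E); last exact: ltry.
apply: lime_le; first by apply: is_cvg_nneseries => n _ _; exact: integral_ge0.
apply: nearW => n.
apply: (@le_trans _ _ (\sum_(0 <= k < n) (a * 2 ^+ N * (1 / 2 ^+ k))%:E)%E).
  apply: lee_sum => k _.
  rewrite /phi; under eq_integral do rewrite EFinM.
  rewrite ge0_integralZl_EFin//; last by apply/measurable_EFinP; exact: measurable_indic.
  rewrite integral_indic// setIT.
  rewrite (_ : a * 2 ^+ N * (1 / 2 ^+ k) = a * (2 ^+ N / 2 ^+ k)); last by ring.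
  by rewrite EFinM; apply: lee_wpmul2l; [rewrite lee_fin|exact: muE].
rewrite sumEFin lee_fin -mulr_sumr ler_wpM2l ?mulr_ge0 ?exprn_ge0//.
suff -> : \sum_(0 <= k < n) (1 / 2 ^+ k) = 2 - 2 / 2 ^+ n :> R.
  by rewrite lerBlDr lerDl divr_ge0// exprn_ge0.
elim: n => [|n IH]; first by rewrite big_geq// expr0 divr1 subrr.
rewrite big_nat_recr//= IH exprS; field.
by rewrite expf_neq0.
Qed.

(** The negative part of [lne r] is exactly the absolute value of [logminus r], so its integral is
    finite and the difference of the two parts cannot be -oo. *)
Lemma integral_lne_gtNy :
  mu.-integrable [set: T] (fun x => logminus (r x)) -> (forall x, 0 <= r x) ->
  (-oo < \int[mu]_x lne (r x)%:E)%E.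
Proof.
move=> iL r0; rewrite integralE.
have -> : ((fun x => lne (r x)%:E)^\- = fun x => `|logminus (r x)|)%E.
  apply/funext => x; rewrite funenegE lee0_abs ?logminus_le0// /logminus.
  case: (leP 1 (r x)) => r1.
    by rewrite lne1 oppe0; apply/max_idPr; rewrite leeNl oppe0 lne_ge0 lee_fin.
  by apply/max_idPl; rewrite oppe_ge0 lne_le0 lee_fin ltW.
have /integrableP[_ fin] := iL.
have p0 : (0 <= \int[mu]_x ((fun x => lne (r x)%:E)^\+ x))%E by apply: integral_ge0.
have n0 : (0 <= \int[mu]_x `|logminus (r x)|)%E by apply: integral_ge0.
have nf : (\int[mu]_x `|logminus (r x)|)%E \is a fin_num by rewrite ge0_fin_numE.
rewrite -(fineK nf).
by case: (\int[mu]_x ((fun x => lne (r x)%:E)^\+ x))%E p0 => [s| |] // _; rewrite -?EFinB ?ltNyr.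
Qed.

End logminus.

(** * Convolution on a compact abelian group *)

Section compact_group.
Context {R : realType} {G : topologicalZmodType}.
Variable mu : probability (borel G) R.
Hypothesis cptG : compact [set: G].
Hypothesis muT : forall (a : G) (A : set (borel G)), measurable A ->
  mu [set a + x | x in (A : set G)] = mu A.

Lemma borel_open (U : set G) : open U -> measurable (U : set (borel G)).
Proof. by move=> oU; exact: sub_sigma_algebra. Qed.

Lemma continuous_borel (f : G -> R) :
  continuous f -> measurable_fun [set: borel G] (f : borel G -> R).
Proof.
move=> /continuousP cf.
apply: (measurability _ (measurable_realfun.RGenOpens.measurableE R)).
move=> _ [_ [a [b ->] <-]]; rewrite setTI; apply: borel_open.
exact/cf/interval_open.
Qed.

Lemma continuous_bound (f : G -> R) :
  continuous f -> exists2 M, 0 < M & forall x, `|f x| <= M.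
Proof.
move=> cf.
have /compact_bounded [M [Mreal fM]] : compact (f @` [set: G]).
  by apply: continuous_compact => //; exact: continuous_subspaceT.
exists (`|M| + 1); first by rewrite ltr_wpDl.
move=> x; apply: fM; last by exists x.
by rewrite (le_lt_trans (ler_norm M))// ltrDl.
Qed.

Lemma continuous_integrable (f : G -> R) (A : set (borel G)) :
  measurable A -> continuous f -> mu.-integrable A (EFin \o f).
Proof.
move=> mA cf; apply: measurable_bounded_integrable => //.
- by rewrite (le_lt_trans (probability_le1 mu mA))// ltry.
- by apply: measurable_funTS; exact: continuous_borel.
- have [M _ fM] := continuous_bound _ cf.
  exists M; split; first exact: num_real.
  by move=> y My x _ /=; rewrite (le_trans (fM x))// ltW.
Qed.

Definition mean (f : G -> R) : R := \int[mu]_x f x.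

Lemma eq_mean (f g : G -> R) : f =1 g -> mean f = mean g.
Proof. by move=> fg; congr mean; apply/funext. Qed.

Lemma meanD (f g : G -> R) : continuous f -> continuous g ->
  mean (fun x => f x + g x) = mean f + mean g.
Proof.
by move=> cf cg; rewrite /mean RintegralD//; exact: continuous_integrable.
Qed.

Lemma meanB (f g : G -> R) : continuous f -> continuous g ->
  mean (fun x => f x - g x) = mean f - mean g.
Proof.
by move=> cf cg; rewrite /mean RintegralB//; exact: continuous_integrable.
Qed.

Lemma meanZ (c : R) (f : G -> R) : continuous f ->
  mean (fun x => c * f x) = c * mean f.
Proof. by move=> cf; rewrite /mean RintegralZl//; exact: continuous_integrable. Qed.

Lemma mean_cst (c : R) : mean (fun=> c) = c.
Proof. by rewrite /mean Rintegral_cst// [X in fine X](_ : _ = 1%E) /= ?mulr1//; exact: probability_setT. Qed.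

Lemma le_mean (f g : G -> R) : continuous f -> continuous g ->
  (forall x, f x <= g x) -> mean f <= mean g.
Proof.
by move=> cf cg fg; rewrite /mean le_Rintegral//; exact: continuous_integrable.
Qed.

Lemma mean_norm (f : G -> R) (M : R) : continuous f ->
  (forall x, `|f x| <= M) -> `|mean f| <= M.
Proof.
move=> cf fM; rewrite ler_norml; apply/andP; split.
- rewrite -(mean_cst (- M)); apply: le_mean => // [x|x]; first exact: cvg_cst.
  by have := fM x; rewrite ler_norml => /andP[].
- rewrite -[leRHS](mean_cst M); apply: le_mean => // [x|x]; first exact: cvg_cst.
  by have := fM x; rewrite ler_norml => /andP[].
Qed.

Lemma continuous_shift (a : G) : continuous (fun x : G => x + a).
Proof.
move=> x.
have := @continuous_comp _ _ _ (fun x : G => (x, a)) (fun p : G * G => p.1 + p.2) x.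
by apply; [apply: cvg_pair; [exact: cvg_id|exact: cvg_cst]|exact: add_continuous].
Qed.

Lemma measurable_shift (a : G) :
  measurable_fun [set: borel G] (fun x : borel G => (x : G) + a : borel G).
Proof.
apply: (@measurability _ _ (borel G) (borel G) setT _ (@open G) erefl) => _ [U oU <-]; rewrite setTI; apply: borel_open.
by apply: (open_comp _ oU) => x _; exact: continuous_shift.
Qed.

Lemma mean_shift (a : G) (f : G -> R) : continuous f ->
  mean (fun x => f (x + a)) = mean f.
Proof.
move=> cf; rewrite /mean /Rintegral; congr fine.
have mf : measurable_fun [set: borel G] (fun x : borel G => (f x)%:E).
  by apply/measurable_EFinP; exact: continuous_borel.
have cfa : continuous (fun x => f (x + a)).
  by move=> x; apply: continuous_comp; [exact: continuous_shift|exact: cf].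
have intf : mu.-integrable [set: borel G] (EFin \o (fun x => f (x + a))).
  exact: continuous_integrable.
have := @integral_pushforward _ _ (borel G) (borel G) R _ (measurable_shift a) mu
  setT (fun x : borel G => (f x)%:E) mf.
rewrite preimage_setT => /(_ intf measurableT) <-.
apply: eq_measure_integral => [|mA0 A mA _]; [exact: measurable_shift|rewrite /pushforward].
have mpre : measurable ((fun x : borel G => (x : G) + a : borel G) @^-1` A).
  by rewrite -[X in measurable X]setTI; exact: measurable_shift.
apply: etrans (esym (muT a _ mpre)) _.
congr (mu _); apply/seteqP; split => [x [y]|x Ax].
  by rewrite /= => Ay <-; rewrite addrC.
by exists (x - a) => /=; rewrite ?subrK// addrC subrK.
Qed.

Lemma continuous_opp : continuous (fun x : G => - x).
Proof. exact: opp_continuous. Qed.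

(** Compactness of G in the variable y makes continuity in x uniform in y; this is the form of
    uniform continuity used for iterated means. *)
Lemma tube (F : G -> G -> R) (e : R) : 0 < e ->
  continuous (fun p : G * G => F p.1 p.2) ->
  forall x, \forall x' \near x, forall y, `|F x' y - F x y| < e.
Proof.
move=> e0 cF x.
have /compact_near_coveringP/(_ _ (nbhs x)) := cptG.
move=> /(_ (fun x' y => `|F x' y - F x y| < e) _) H.
suff /H H1 : forall y : G, setT y ->
    \forall y' \near y & x' \near x, `|F x' y' - F x y'| < e.
  by near=> x' => y; apply: (near H1 x').
move=> y _.
have c1 : (fun p : G * G => F p.2 p.1 - F x p.1) @ (y, x) --> (0 : R).
  rewrite -[X in _ --> X](subrr (F x y)); apply: cvgB.
    have := @continuous_comp _ _ _ (fun p : G * G => (p.2, p.1)) (fun p : G * G => F p.1 p.2) (y, x).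
    by apply; [apply: cvg_pair; [exact: cvg_snd|exact: cvg_fst]|exact: cF].
  have := @continuous_comp _ _ _ (fun p : G * G => (x, p.1)) (fun p : G * G => F p.1 p.2) (y, x).
  by apply; [apply: cvg_pair; [exact: cvg_cst|exact: cvg_fst]|exact: cF].
have /cvgr0_norm_lt/(_ _ e0) := c1.
by [].
Unshelve. all: end_near. Qed.

(** The nodes and weights [s] depend only on the cover, so one Riemann sum serves every f of
    oscillation at most e on the cover; [mean_fubini] relies on this order of quantifiers. Each
    induction step cuts off the piece of B inside [U x], with node x and its measure as weight. *)
Lemma mean_approx_on (U : G -> set G) (xs : seq G) (B : set (borel G)) :
  (forall x, open (U x)) -> measurable B ->
  (forall z, B z -> exists2 x, x \in xs & U x z) ->
  exists s : seq (R * G), forall (f : G -> R) (e : R), continuous f ->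
    (forall x x', U x x' -> `|f x' - f x| <= e) ->
    `|\int[mu]_(x in B) f x - \sum_(p <- s) p.1 * f p.2| <= e * fine (mu B).
Proof.
move=> oU; elim: xs B => [|x xs IH] B mB HB.
  exists [::] => f e cf _; have -> : B = set0.
    by apply/seteqP; split => // z /HB[].
  by rewrite Rintegral_set0 big_nil subr0 normr0 measure0 mulr0.
have mU : measurable (U x : set (borel G)) by exact: borel_open.
have mB1 : measurable (B `&` U x) by exact: measurableI.
have mB2 : measurable (B `\` U x) by exact: measurableD.
have [|s Hs] := IH _ mB2.
  move=> z [Bz nUz]; have [x' + Ux'] := HB _ Bz.
  by rewrite inE => /predU1P[xx'|x'xs]; [rewrite xx' in Ux'|exists x'].
exists ((fine (mu (B `&` U x)), x) :: s) => f e cf osc.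
have BE : B = (B `&` U x) `|` (B `\` U x) by rewrite setUIDK.
have dis : [disjoint B `&` U x & B `\` U x]%classic.
  by apply/disj_set2P; apply/seteqP; split => // z [[_ ?] [_ ?]].
have ifB A : measurable A -> mu.-integrable A (EFin \o f).
  by move=> mA; exact: continuous_integrable.
rewrite {1}BE Rintegral_setU//; last by apply: ifB; rewrite -BE.
have fin A : measurable A -> mu A \is a fin_num by exact: fin_num_measure.
have muB : fine (mu B) = fine (mu (B `&` U x)) + fine (mu (B `\` U x)).
  rewrite {1}BE measureU//; last exact/disj_set2P.
  by rewrite fineD//; exact: fin.
rewrite big_cons/= muB mulrDr.
rewrite opprD addrACA (le_trans (ler_normD _ _))// lerD//; last exact: Hs.
have cst A : measurable A -> mu.-integrable A (EFin \o (fun=> f x)).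
  by move=> mA; apply: continuous_integrable => // ?; exact: cvg_cst.
rewrite mulrC -Rintegral_cst// -RintegralB//; [|exact: ifB|exact: cst].
have cB : continuous (fun y => f y - f x).
  by move=> y; apply: cvgB; [exact: cf|exact: cvg_cst].
apply: (le_trans (le_normr_Rintegral _ _)) => //; first exact: continuous_integrable.
rewrite -Rintegral_cst//; apply: le_Rintegral => //.
- by apply: continuous_integrable => // y; apply: cvg_norm; exact: cB.
- by apply: continuous_integrable => // ?; exact: cvg_cst.
- by move=> z [_ Uz]; exact: osc.
Qed.

Lemma mean_approx (U : G -> set G) : (forall x, nbhs x (U x)) ->
  exists s : seq (R * G), forall (f : G -> R) (e : R), continuous f ->
    (forall x x', U x x' -> `|f x' - f x| <= e) ->
    `|mean f - \sum_(p <- s) p.1 * f p.2| <= e.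
Proof.
move=> nU.
have := cptG; rewrite compact_cover => /(_ G setT (fun x => (U x)°)) [].
- by move=> i _; exact: open_interior.
- by move=> x _; exists x => //; exact: nU.
move=> D _ HD.
have [||z _|s Hs] := mean_approx_on (fun x => (U x)°) (finmap.enum_fset D) [set: borel G].
- by move=> x; exact: open_interior.
- exact: measurableT.
- by have [x /= Dx Uxz] := HD z I; exists x.
exists s => f e cf osc; rewrite -[leRHS]mulr1.
have -> : 1 = fine (mu [set: borel G]) by rewrite probability_setT.
by apply: Hs => // x x' /interior_subset; exact: osc.
Qed.

Lemma continuous_slice1 (F : G -> G -> R) (y : G) :
  continuous (fun p : G * G => F p.1 p.2) -> continuous (fun x => F x y).
Proof.
move=> cF x.
have := @continuous_comp _ _ _ (fun x : G => (x, y)) (fun p : G * G => F p.1 p.2) x.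
by apply; [apply: cvg_pair; [exact: cvg_id|exact: cvg_cst]|exact: cF].
Qed.

Lemma continuous_slice2 (F : G -> G -> R) (x : G) :
  continuous (fun p : G * G => F p.1 p.2) -> continuous (F x).
Proof.
move=> cF y.
have := @continuous_comp _ _ _ (fun y : G => (x, y)) (fun p : G * G => F p.1 p.2) y.
by apply; [apply: cvg_pair; [exact: cvg_cst|exact: cvg_id]|exact: cF].
Qed.

Lemma continuous_mean (F : G -> G -> R) :
  continuous (fun p : G * G => F p.1 p.2) -> continuous (fun x => mean (F x)).
Proof.
move=> cF x; apply/cvgrPdist_le => e e0.
have := tube _ _ e0 cF x; apply: filterS => x' H.
rewrite -meanB; [|exact: continuous_slice2..].
apply: mean_norm => [y|y].
  by apply: cvgB; apply: continuous_slice2.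
by rewrite distrC ltW.
Qed.

Lemma continuous_flip (F : G -> G -> R) :
  continuous (fun p : G * G => F p.1 p.2) -> continuous (fun p : G * G => F p.2 p.1).
Proof.
move=> cF p.
have := @continuous_comp _ _ _ (fun p : G * G => (p.2, p.1)) (fun p : G * G => F p.1 p.2) p.
by apply; [apply: cvg_pair; [exact: cvg_snd|exact: cvg_fst]|exact: cF].
Qed.

Lemma mean_sum (s : seq (R * G)) (F : G -> G -> R) :
  continuous (fun p : G * G => F p.1 p.2) ->
  continuous (fun y => \sum_(p <- s) p.1 * F p.2 y) /\
  mean (fun y => \sum_(p <- s) p.1 * F p.2 y) = \sum_(p <- s) p.1 * mean (F p.2).
Proof.
move=> cF; elim: s => [|p s [IH1 IH2]].
  split; first by under eq_fun do rewrite big_nil; move=> ?; exact: cvg_cst.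
  by rewrite big_nil; under eq_mean do rewrite big_nil; rewrite mean_cst.
have c1 : continuous (fun y => p.1 * F p.2 y).
  by move=> y; apply: cvgMr; exact: continuous_slice2.
split.
  under eq_fun do rewrite big_cons.
  by move=> y; apply: cvgD; [exact: c1|exact: IH1].
under eq_mean do rewrite big_cons.
by rewrite meanD// meanZ ?big_cons ?IH2//; exact: continuous_slice2.
Qed.

(* The product of two Borel sigma-algebras need not contain the open subsets of
   G * G, so the Fubini theorem of the library does not apply; both iterated
   means are approximated by the same Riemann sum. *)
Lemma mean_fubini (F : G -> G -> R) :
  continuous (fun p : G * G => F p.1 p.2) ->
  mean (fun x => mean (F x)) = mean (fun y => mean (fun x => F x y)).
Proof.
move=> cF; apply/eqP; rewrite -subr_eq0 -normr_le0; apply/ler_addgt0Pl => e e0.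
rewrite addr0; have e20 : 0 < e / 2 by rewrite divr_gt0.
have [s Hs] := mean_approx (fun x => [set x' | forall y, `|F x' y - F x y| < e / 2])
  (tube _ _ e20 cF).
have [cS mS] := mean_sum s _ cF.
have H1 : `|mean (fun x => mean (F x)) - \sum_(p <- s) p.1 * mean (F p.2)| <= e / 2.
  apply: (Hs (fun x => mean (F x))) => [|x x' H]; first exact: continuous_mean.
  rewrite -meanB; [|exact: continuous_slice2..].
  apply: mean_norm => [y|y]; last by rewrite ltW.
  by apply: cvgB; exact: continuous_slice2.
have cM : continuous (fun y => mean (fun x => F x y)).
  by apply: (continuous_mean (fun y x => F x y)); exact: continuous_flip.
have H2 : `|mean (fun y => mean (fun x => F x y)) - \sum_(p <- s) p.1 * mean (F p.2)| <= e / 2.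
  rewrite -mS -meanB//; apply: mean_norm => [y|y].
    by apply: cvgB; [exact: cM|exact: cS].
  apply: (Hs (fun x => F x y)) => [|x x' H]; first exact: continuous_slice1.
  by rewrite ltW.
rewrite (splitr e); apply: le_trans (lerD H1 H2).
rewrite [`|_ - _| in X in _ <= _ + X]distrC; apply: le_trans (ler_normD _ _).
by rewrite addrA subrK.
Qed.

(** Invariance under inversion follows from translation invariance by integrating f (x - y) in both
    orders: over x first gives [mean f], over y first gives the mean of f (- y). *)
Lemma mean_opp (f : G -> R) : continuous f -> mean (fun x => f (- x)) = mean f.
Proof.
move=> cf.
have cS : continuous (fun p : G * G => p.1 - p.2).
  by move=> p; apply: sub_continuous.
have cF : continuous (fun p : G * G => f (p.1 - p.2)).
  by move=> p; apply: continuous_comp; [exact: cS|exact: cf].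
have := mean_fubini (fun x y => f (x - y)) cF.
under [in RHS]eq_mean => y do rewrite (mean_shift (- y))//.
rewrite mean_cst => <-.
transitivity (mean (fun=> mean (fun x => f (- x)))); first by rewrite mean_cst.
apply: eq_mean => x.
rewrite -[LHS](mean_shift (- x)).
  by apply: eq_mean => y; rewrite opprD opprK addrC.
by move=> y; apply: continuous_comp; [exact: continuous_opp|exact: cf].
Qed.

(** Finitely many translates of the open set where f > f a / 2 cover G. The sum of the corresponding
    translates of f is at least f a / 2 everywhere, and its mean is a multiple of [mean f]. *)
Lemma mean_gt0 (f : G -> R) : continuous f -> (forall x, 0 <= f x) ->
  (exists x, 0 < f x) -> 0 < mean f.
Proof.
move=> cf f0 [a fa].
pose c := f a / 2.
have c0 : 0 < c by rewrite divr_gt0.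
pose U := [set x | c < f x].
have oU : open U.
  by move: cf => /continuousP/(_ _ (@open_gt R c)).
have cover : [set: G] `<=` \bigcup_(b in [set: G]) [set x | U (x + b)].
  by move=> x _; exists (a - x) => //=; rewrite /U/= addrC subrK /c ltr_pdivrMr// mulr_natr mulr2n ltrDl.
have := cptG; rewrite compact_cover => /(_ G setT (fun b => [set x | U (x + b)])) [|//|].
  move=> b _; apply: (open_comp _ oU) => x _; exact: continuous_shift.
move=> D _ HD.
pose g (x : G) := \sum_(b <- finmap.enum_fset D) f (x + b).
have csh b : continuous (fun x => f (x + b)).
  by move=> x; apply: continuous_comp; [exact: continuous_shift|exact: cf].
have gE (s : seq G) : continuous (fun x => \sum_(b <- s) f (x + b)) /\
    mean (fun x => \sum_(b <- s) f (x + b)) = mean f *+ size s.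
  elim: s => [|b s [IH1 IH2]].
    split; first by under eq_fun do rewrite big_nil; move=> ?; exact: cvg_cst.
    by under eq_mean do rewrite big_nil; rewrite mean_cst.
  split; first by under eq_fun do rewrite big_cons; move=> y; apply: cvgD; [exact: csh|exact: IH1].
  under eq_mean do rewrite big_cons.
  by rewrite meanD// IH2 mean_shift//= mulrS.
have [cg mg] := gE (finmap.enum_fset D).
have : c <= mean g.
  rewrite -(mean_cst c); apply: le_mean => //[?|x]; first exact: cvg_cst.
  have [b Db Ub] := HD x I.
  rewrite /g (bigD1_seq b) ?finmap.fset_uniq//=.
  by rewrite -[leLHS]addr0 lerD// ?sumr_ge0// ltW.
rewrite /g mg => cm.
case: (ltP 0 (mean f)) => // mf; exfalso.
suff : c <= 0 by rewrite leNgt c0.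
by rewrite (le_trans cm)// mulrn_wle0.
Qed.

(** * The convolution algebra of continuous real functions *)

Record cfun := CFun { cfun_val :> G -> R ; cfun_cont : continuous cfun_val }.

(** Pointwise identities become equalities, so the laws of the convolution algebra can be used by
    rewriting. *)
Lemma cfunP (f g : cfun) : f =1 g -> f = g.
Proof.
case: f g => [f cf] [g cg] /= /funext fg; subst g; congr CFun.
exact: Prop_irrelevance.
Qed.

Lemma cfun_comp (f : cfun) (T : topologicalType) (k : T -> G) :
  continuous k -> continuous (fun t => f (k t)).
Proof. by move=> ck t; apply: continuous_comp; [exact: ck|exact: cfun_cont]. Qed.

Lemma continuous_comp2 (T : topologicalType) (k1 k2 : T -> G) :
  continuous k1 -> continuous k2 -> continuous (fun t => k1 t - k2 t).
Proof.
move=> c1 c2 t.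
have := @continuous_comp _ _ _ (fun t => (k1 t, k2 t)) (fun p : G * G => p.1 - p.2) t.
by apply; [apply: cvg_pair; [exact: c1|exact: c2]|exact: sub_continuous].
Qed.

Lemma continuous_mul (T : topologicalType) (f g : T -> R) :
  continuous f -> continuous g -> continuous (fun t => f t * g t).
Proof. by move=> cf cg t; apply: cvgM; [exact: cf|exact: cg]. Qed.

Lemma continuous_fst : continuous (fun p : G * G => p.1).
Proof. by move=> p; exact: cvg_fst. Qed.

Lemma continuous_snd : continuous (fun p : G * G => p.2).
Proof. by move=> p; exact: cvg_snd. Qed.

Lemma continuous_cst (T : topologicalType) (c : G) : continuous (fun _ : T => c).
Proof. by move=> ?; exact: cvg_cst. Qed.

Lemma conv_integrand_cont (f g : cfun) :
  continuous (fun p : G * G => f (p.1 - p.2) * g p.2).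
Proof.
apply: continuous_mul; apply: cfun_comp; last exact: continuous_snd.
by apply: continuous_comp2; [exact: continuous_fst|exact: continuous_snd].
Qed.

Definition conv (f g : cfun) : cfun :=
  CFun _ (continuous_mean (fun x y => f (x - y) * g y) (conv_integrand_cont f g)).

Lemma convE (f g : cfun) x : conv f g x = mean (fun y => f (x - y) * g y).
Proof. by []. Qed.

Lemma cont_id : continuous (@id G). Proof. by move=> ?; exact: cvg_id. Qed.

Lemma conv_slice_cont (f g : cfun) (x : G) : continuous (fun y => f (x - y) * g y).
Proof.
apply: continuous_mul; apply: cfun_comp; last exact: cont_id.
by apply: continuous_comp2; [exact: continuous_cst|exact: cont_id].
Qed.

Lemma convC (f g : cfun) : conv f g = conv g f.
Proof.
apply: cfunP => x; rewrite !convE -[LHS](mean_opp _ (conv_slice_cont f g x)).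
rewrite -[LHS](mean_shift (- x)); last first.
  have := conv_slice_cont f g x => c y.
  by apply: (@continuous_comp _ _ _ (fun y : G => - y) (fun y => f (x - y) * g y)); [exact: opp_continuous|exact: c].
by apply: eq_mean => y; rewrite opprK opprB (addrC x) subrK mulrC.
Qed.

Lemma cadd_cont (f g : cfun) : continuous (fun x => f x + g x).
Proof. by move=> x; apply: cvgD; exact: cfun_cont. Qed.
Definition cadd f g := CFun _ (cadd_cont f g).

Lemma cscale_cont (c : R) (f : cfun) : continuous (fun x => c * f x).
Proof. by move=> x; apply: cvgMr; exact: cfun_cont. Qed.
Definition cscale c f := CFun _ (cscale_cont c f).

Lemma caddE f g x : cadd f g x = f x + g x. Proof. by []. Qed.
Lemma cscaleE c f x : cscale c f x = c * f x. Proof. by []. Qed.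

Definition csub f g := cadd f (cscale (-1) g).

Lemma csubE f g x : csub f g x = f x - g x.
Proof. by rewrite /= mulN1r. Qed.

Lemma cshift_cont (a : G) (f : cfun) : continuous (fun x => f (x + a)).
Proof. by apply: cfun_comp; exact: continuous_shift. Qed.
Definition cshift a f := CFun _ (cshift_cont a f).

Lemma cshiftE a f x : cshift a f x = f (x + a). Proof. by []. Qed.

Lemma cflip_cont (f : cfun) : continuous (fun x => f (- x)).
Proof. by apply: cfun_comp => x; exact: opp_continuous. Qed.
Definition cflip f := CFun _ (cflip_cont f).

Lemma convDr f g h : conv f (cadd g h) = cadd (conv f g) (conv f h).
Proof.
apply: cfunP => x; rewrite /= -meanD; [|exact: conv_slice_cont..].
by apply: eq_mean => y; rewrite mulrDr.
Qed.

Lemma convZr c f g : conv f (cscale c g) = cscale c (conv f g).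
Proof.
apply: cfunP => x; rewrite /= -meanZ; last exact: conv_slice_cont.
by apply: eq_mean => y; rewrite mulrCA.
Qed.

Lemma convDl f g h : conv (cadd f g) h = cadd (conv f h) (conv g h).
Proof. by rewrite convC convDr !(convC h). Qed.

Lemma convZl c f g : conv (cscale c f) g = cscale c (conv f g).
Proof. by rewrite convC convZr convC. Qed.

Lemma conv_shiftl a f g : conv (cshift a f) g = cshift a (conv f g).
Proof. by apply: cfunP => x /=; apply: eq_mean => y; rewrite addrAC. Qed.

Lemma conv_shiftr a f g : conv f (cshift a g) = cshift a (conv f g).
Proof. by rewrite convC conv_shiftl convC. Qed.

Lemma convA f g h : conv f (conv g h) = conv (conv f g) h.
Proof.
apply: cfunP => x; rewrite !convE.
transitivity (mean (fun y => mean (fun z => f (x - y) * (g (y - z) * h z)))).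
  by apply: eq_mean => y; rewrite convE -meanZ//; exact: conv_slice_cont.
rewrite (mean_fubini (fun y z => f (x - y) * (g (y - z) * h z))); last first.
  apply: continuous_mul; last exact: conv_integrand_cont.
  by apply: cfun_comp; apply: continuous_comp2; [exact: continuous_cst|exact: continuous_fst].
apply: eq_mean => z; rewrite convE mulrC -meanZ; last exact: conv_slice_cont.
rewrite -[LHS](mean_shift z).
  by apply: eq_mean => y; rewrite addrK opprD (addrC (- y)) addrA mulrA mulrC.
apply: continuous_mul.
  by apply: cfun_comp; apply: continuous_comp2; [exact: continuous_cst|exact: cont_id].
apply: continuous_mul; apply: cfun_comp; last exact: continuous_cst.
by apply: continuous_comp2; [exact: cont_id|exact: continuous_cst].
Qed.

Definition inner (f g : cfun) : R := mean (fun x => f x * g x).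

Lemma inner_cont (f g : cfun) : continuous (fun x => f x * g x).
Proof. by apply: continuous_mul; exact: cfun_cont. Qed.

Lemma innerC f g : inner f g = inner g f.
Proof. by apply: eq_mean => x; rewrite mulrC. Qed.

Lemma innerDr f g h : inner f (cadd g h) = inner f g + inner f h.
Proof.
by rewrite /inner -meanD; [apply: eq_mean => x; rewrite mulrDr|exact: inner_cont..].
Qed.

Lemma innerZr c f g : inner f (cscale c g) = c * inner f g.
Proof.
by rewrite /inner -meanZ; [apply: eq_mean => x; rewrite mulrCA|exact: inner_cont].
Qed.

Lemma innerDl f g h : inner (cadd f g) h = inner f h + inner g h.
Proof. by rewrite innerC innerDr !(innerC h). Qed.

Lemma innerZl c f g : inner (cscale c f) g = c * inner f g.
Proof. by rewrite innerC innerZr innerC. Qed.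

Lemma inner_ge0 f : 0 <= inner f f.
Proof.
rewrite -(mean_cst 0); apply: le_mean => [?||x]; first exact: cvg_cst.
  exact: inner_cont.
by rewrite -expr2 sqr_ge0.
Qed.

Lemma inner_gt0 (f : cfun) x : f x != 0 -> 0 < inner f f.
Proof.
move=> fx; apply: mean_gt0; first exact: inner_cont.
  by move=> y; rewrite -expr2 sqr_ge0.
by exists x; rewrite -expr2 exprn_even_gt0.
Qed.

Lemma cauchy_schwarz f g : inner f g ^+ 2 <= inner f f * inner g g.
Proof.
have H t : 0 <= inner f f + 2 * t * inner f g + t ^+ 2 * inner g g.
  have := inner_ge0 (cadd f (cscale t g)).
  rewrite innerDl !innerDr !innerZl !innerZr (innerC g f).
  by congr (0 <= _); ring.
have [g0|gN] := eqVneq (inner g g) 0.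
  have [->|fgN] := eqVneq (inner f g) 0; first by rewrite expr0n/= g0 mulr0.
  (* For [inner g g = 0] the expression is affine in t; this t gives it the value -1. *)
  have := H (- (inner f f + 1) / (2 * inner f g)).
  rewrite g0 mulr0 addr0.
  have -> : 2 * (- (inner f f + 1) / (2 * inner f g)) * inner f g = - (inner f f + 1).
    by field.
  by rewrite opprD addrA subrr add0r lerNr oppr0 ler10.
have gp : 0 < inner g g by rewrite lt_def gN inner_ge0.
have := H (- inner f g / inner g g).
have -> : inner f f + 2 * (- inner f g / inner g g) * inner f g +
  (- inner f g / inner g g) ^+ 2 * inner g g = inner f f - inner f g ^+ 2 / inner g g.
  by field.
by rewrite subr_ge0 ler_pdivrMr.
Qed.

Definition even_cfun (f : cfun) := forall x, f (- x) = f x.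

(** Evaluation at 0 acts as a trace: it turns identities between convolutions of even functions into
    identities between inner products. *)
Lemma conv0 f g : even_cfun f -> conv f g 0 = inner f g.
Proof. by move=> ef; apply: eq_mean => y; rewrite add0r ef. Qed.

Lemma conv_even f g : even_cfun f -> even_cfun g -> even_cfun (conv f g).
Proof.
move=> ef eg x; rewrite !convE -[LHS]mean_opp; last exact: conv_slice_cont.
by apply: eq_mean => y; rewrite -opprD ef eg.
Qed.

(** Cauchy-Schwarz for g and y -> f (x - y), which has the same norm as f. Convolving once more thus
    turns mean square estimates into uniform ones. *)
Lemma conv_le f g x : conv f g x ^+ 2 <= inner f f * inner g g.
Proof.
have cr : continuous (fun y => f (x - y)).
  by apply: cfun_comp; apply: continuous_comp2; [exact: continuous_cst|exact: cont_id].
have := cauchy_schwarz (CFun _ cr) g.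
suff -> : inner (CFun _ cr) (CFun _ cr) = inner f f by [].
rewrite /inner /= -[LHS]mean_opp; last by apply: continuous_mul.
rewrite -[LHS](mean_shift (- x)); last first.
  apply: continuous_mul => y; apply: cfun_comp => {}y;
  by apply: continuous_comp2 => {}y; [exact: cvg_cst|exact: opp_continuous].
by apply: eq_mean => y; rewrite opprK (addrC x) subrK.
Qed.

Lemma conv_unif (f g : cfun) (M e : R) x : 0 <= e -> (forall x, `|f x| <= M) ->
  (forall x, `|g x| <= e) -> `|conv f g x| <= M * e.
Proof.
move=> e0 fM ge; apply: mean_norm => [|y]; first exact: conv_slice_cont.
by rewrite normrM ler_pM.
Qed.

Lemma uniform_limit (u : nat -> cfun) :
  (forall e, 0 < e -> exists N, forall n m x, (N <= n)%N -> (N <= m)%N ->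
     `|u n x - u m x| <= e) ->
  exists p : cfun, forall e, 0 < e -> exists N, forall n x, (N <= n)%N -> `|u n x - p x| <= e.
Proof.
move=> uC.
have cv x : cvgn (fun n => u n x).
  apply/cauchy_cvgP/cauchy_exP => e e0.
  have [N HN] := uC (e / 2) (divr_gt0 e0 (ltr0Sn _ 1)).
  exists (u N x); exists N => // n /= Nn.
  by rewrite /ball/= (le_lt_trans (HN _ _ _ _ _))// ltr_pdivrMr// mulr_natr mulr2n ltrDl.
pose p x := limn (fun n => u n x).
have H e : 0 < e -> exists N, forall n x, (N <= n)%N -> `|u n x - p x| <= e.
  move=> e0; have [N HN] := uC e e0; exists N => n x Nn.
  have c : (fun m => `|u n x - u m x|) @ \oo --> `|u n x - p x|.
    by apply: cvg_norm; apply: cvgB; [exact: cvg_cst|exact: cv].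
  apply: (cvgr_to_le c); near=> m; apply: HN => //.
  by near: m; exists N.
have cp : continuous p.
  move=> x; apply/cvgrPdist_le => e e0.
  have e30 : 0 < e / 3 by rewrite divr_gt0.
  have [N HN] := H _ e30.
  have /cvgrPdist_le/(_ _ e30) := cfun_cont (u N) x.
  apply: filterS => y Hy.
  have -> : p x - p y = (u N x - u N y) - (u N x - p x) + (u N y - p y) by ring.
  have -> : e = e / 3 + e / 3 + e / 3 by field.
  rewrite (le_trans (ler_normD _ _))// lerD//; last exact: HN.
  by rewrite (le_trans (ler_normB _ _))// lerD//; exact: HN.
by exists (CFun p cp).
Unshelve. all: end_near. Qed.

Lemma conv_limit (f : cfun) (u : nat -> cfun) (p q : cfun) :
  (forall e, 0 < e -> exists N, forall n x, (N <= n)%N -> `|u n x - p x| <= e) ->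
  (forall e, 0 < e -> exists N, forall n x, (N <= n)%N -> `|conv f (u n) x - q x| <= e) ->
  conv f p = q.
Proof.
move=> up uq; apply: cfunP => x; apply/eqP; rewrite -subr_eq0 -normr_le0.
apply/ler_addgt0Pl => e e0; rewrite addr0.
have [M M0 fM] := continuous_bound f (cfun_cont f).
have e20 : 0 < e / 2 by rewrite divr_gt0.
have [N1 HN1] := up (e / 2 / M) (divr_gt0 e20 M0).
have [N2 HN2] := uq (e / 2) e20.
pose n := maxn N1 N2.
have H1 : `|conv f p x - conv f (u n) x| <= e / 2.
  rewrite distrC -csubE.
  have -> : csub (conv f (u n)) (conv f p) = conv f (csub (u n) p).
    by rewrite /csub convDr convZr.
  rewrite -[leRHS](divfK (lt0r_neq0 M0)) mulrC; apply: conv_unif => //.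
    by rewrite divr_ge0// ltW.
  by move=> y; rewrite csubE HN1// leq_maxl.
rewrite (splitr e) -(subrKA (conv f (u n) x)) (le_trans (ler_normD _ _))// lerD//.
by rewrite HN2// leq_maxr.
Qed.

(** * Convolution idempotents and the power method *)

Definition idem (p : cfun) := even_cfun p /\ conv p p = p.

(** Convolution with p is an orthogonal projection, and p 0 = [inner p p] is its trace. Since |p| is
    bounded by p 0, this inner product is at most (p 0)^2. The gap between 0 and 1 makes the descent
    in [exists_rank_one] finite. *)
Lemma idem0_ge1 (p : cfun) x : idem p -> p x != 0 -> 1 <= p 0.
Proof.
move=> [ep pp] px.
have p0 : p 0 = inner p p by rewrite -{1}pp conv0.
have pp0 : 0 < p 0 by rewrite p0; exact: inner_gt0 px.
have pb y : `|p y| <= p 0.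
  rewrite -(@ler_pXn2r _ 2)// ?nnegrE ?(ltW pp0)// real_normK ?num_real//.
  by rewrite -{1}pp (le_trans (conv_le _ _ _))// -p0 expr2.
rewrite -(ler_pM2r pp0) mul1r {1}p0.
have := mean_norm (fun y => p y * p y) (p 0 * p 0) (inner_cont p p).
rewrite -/(inner p p) ger0_norm ?inner_ge0//; apply => y.
by rewrite normrM ler_pM.
Qed.

Section iterate.
Variable s : cfun.
Hypothesis s_even : even_cfun s.
Hypothesis s_neq0 : exists x, s x != 0.

(** There is no zeroth power, the algebra having in general no unit: [cpow n] is the convolution
    power of exponent n + 1, whence the shifts [(n + m).+1]. *)
Fixpoint cpow (n : nat) : cfun := if n is n'.+1 then conv s (cpow n') else s.

Lemma cpowD n m : conv (cpow n) (cpow m) = cpow (n + m).+1.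
Proof. by elim: n => [//|n IH]; rewrite /= -convA IH. Qed.

Lemma cpow_even n : even_cfun (cpow n).
Proof. by elim: n => [//|n IH] /=; exact: conv_even. Qed.

Lemma inner_cpow n m : inner (cpow n) (cpow m) = cpow (n + m).+1 0.
Proof. by rewrite -cpowD conv0//; exact: cpow_even. Qed.

Let a n := inner (cpow n) (cpow n).

Let aE n : a n = cpow (n + n).+1 0.
Proof. exact: inner_cpow. Qed.

Let a_gt0 n : 0 < a n.
Proof.
(* Two consecutive terms are carried along, because positivity of [a n] and [a n.+1] gives that of
   [a n.+2] through the Cauchy-Schwarz inequality [a n.+1 ^+ 2 <= a n * a n.+2]. *)
suff : 0 < a n /\ 0 < a n.+1 by case.
elim: n => [|n [a1 a2]].
  have [x sx] := s_neq0.
  have a00 : 0 < a 0%N by exact: (inner_gt0 _ _ sx).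
  by split => //; apply: (inner_gt0 _ 0); rewrite gt_eqF// -[ltRHS]/(cpow (0 + 0).+1 0) -aE.
split => //; rewrite -(pmulr_rgt0 _ a1).
have := cauchy_schwarz (cpow n) (cpow n.+2); apply: lt_le_trans.
by rewrite inner_cpow addnS -addSn -[X in 0 < X ^+ 2]inner_cpow exprn_gt0.
Qed.

Let a_convex n : a n.+1 ^+ 2 <= a n * a n.+2.
Proof.
have := cauchy_schwarz (cpow n) (cpow n.+2); apply: le_trans.
by rewrite inner_cpow addnS -addSn -[X in _ <= X ^+ 2]inner_cpow.
Qed.

Let cpow_bound n x : `|cpow (n + n).+1 x| <= a n.
Proof.
rewrite -(@ler_pXn2r _ 2)// ?nnegrE ?(ltW (a_gt0 n))// real_normK ?num_real//.
by rewrite -cpowD (le_trans (conv_le _ _ _))// expr2.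
Qed.

(** The left side is the inner product of two powers whose sup norms are at most [a n] and [a m] by
    [cpow_bound]. *)
Let a_submul n m : a (n + m).+1 <= a n * a m.
Proof.
have E : a (n + m).+1 = inner (cpow (n + n).+1) (cpow (m + m).+1).
  by rewrite inner_cpow aE; congr (cpow _ 0); lia.
rewrite E (le_trans (ler_norm _))//.
apply: mean_norm => [|y]; first exact: inner_cont.
by rewrite normrM ler_pM.
Qed.

(* The normalized even convolution powers of s converge uniformly to the
   spectral projection onto the top eigenspace of s * s. *)
Lemma power_method : exists p l, [/\ 0 < l, idem p, 1 <= p 0 &
  conv (conv s s) p = cscale l p].
Proof.
have [l [l0 la al]] := ratio_limit _ a a_gt0 a_convex a_submul.
pose b n := a n / l ^+ n.+1.
have lX n : 0 < l ^+ n by rewrite exprn_gt0.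
have b1 n : 1 <= b n by rewrite /b ler_pdivlMr// mul1r.
have bS n : b n.+1 <= b n.
  rewrite /b ler_pdivrMr//.
  have -> : a n / l ^+ n.+1 * l ^+ n.+2 = l * a n.
    by rewrite [l ^+ n.+2]exprS mulrCA divfK// lt0r_neq0.
  exact: al.
have bM : {homo b : n m / (n <= m)%N >-> m <= n} by apply/nonincreasing_seqP.
have bC : cvgn b.
  by apply: nonincreasing_is_cvgn => //; exists 1 => _ [n _ <-].
(* [u n] is the power of exponent n + 1 of l^-1 (s conv s); only its semigroup law, its evenness and
   [u n 0 = b n] are used for convergence. *)
pose u n := cscale (l ^- n.+1) (cpow (n + n).+1).
have uD n m : conv (u n) (u m) = u (n + m).+1.
  have E1 : ((n + n).+1 + (m + m).+1).+1 = ((n + m).+1 + (n + m).+1).+1 by lia.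
  have E2 : (n.+1 + m.+1 = (n + m).+2)%N by lia.
  rewrite /u convZr convZl cpowD E1; apply: cfunP => x.
  rewrite !cscaleE.
  by rewrite mulrA -invfM -exprD ?E2// addnC E2.
have u0 n : u n 0 = b n by rewrite /u cscaleE -aE mulrC.
have u_even n : even_cfun (u n) by move=> x; rewrite /u !cscaleE cpow_even.
have uI n m : inner (u n) (u m) = b (n + m).+1.
  by rewrite -conv0// uD u0.
have uS g : cscale l (conv (u 0%N) g) = conv (conv s s) g.
  by rewrite /u expr1 convZl; apply: cfunP => x; rewrite !cscaleE mulVKf// lt0r_neq0.
clearbody u.
have uC e : 0 < e -> exists N, forall n m x, (N <= n)%N -> (N <= m)%N ->
     `|u n x - u m x| <= e.
  move=> e0.
  have B0 : 0 < b 1%N by exact: lt_le_trans (b1 1%N).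
  have c0 : 0 < e ^+ 2 / (2 * b 1%N) by apply: divr_gt0; [exact: exprn_gt0|apply: mulr_gt0].
  have c20 : 0 < e ^+ 2 / (2 * b 1%N) / 2 by rewrite divr_gt0.
  have /cvgrPdist_lt/(_ _ c20) [N _ PN] := bC.
  have HN n m : (N <= n)%N -> (N <= m)%N -> `|b n - b m| < e ^+ 2 / (2 * b 1%N).
    move=> /PN/= Pn /PN/= Pm; rewrite (splitr (_ / _)) -(subrKA (limn b)).
    by rewrite (le_lt_trans (ler_normD _ _))// ltrD// distrC.
  (* The squared norm of u_n - u_m is b (2n+1) + b (2m+1) - 2 b (n+m+1), small because b converges.
     The indices are raised by one so that a factor [u 0], of squared norm [b 1], can be split off
     and [conv_le] applied. *)
  exists N.+1 => -[//|n] [//|m] x; rewrite !ltnS => Nn Nm.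
  rewrite -(@ler_pXn2r _ 2)// ?nnegrE ?(ltW e0)// real_normK ?num_real//.
  have E k : u k.+1 = conv (u 0%N) (u k) by rewrite uD add0n.
  rewrite -csubE !E.
  have -> : csub (conv (u 0%N) (u n)) (conv (u 0%N) (u m)) = conv (u 0%N) (csub (u n) (u m)).
    by rewrite /csub convDr convZr.
  apply: (le_trans (conv_le _ _ _)); rewrite uI addn0.
  rewrite /csub innerDl !innerDr !innerZl !innerZr !uI (addnC m n).
  rewrite mulrC -ler_pdivlMr//.
  have h1 : `|b (n + n).+1 - b (n + m).+1| < e ^+ 2 / (2 * b 1%N) by apply: HN; lia.
  have h2 : `|b (m + m).+1 - b (n + m).+1| < e ^+ 2 / (2 * b 1%N) by apply: HN; lia.
  have -> : e ^+ 2 / b 1%N = e ^+ 2 / (2 * b 1%N) + e ^+ 2 / (2 * b 1%N).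
    by field; rewrite lt0r_neq0.
  rewrite (le_trans _ (lerD (ltW h1) (ltW h2)))//.
  by rewrite (le_trans _ (lerD (ler_norm _) (ler_norm _)))//; lra.
have [p up] := uniform_limit u uC.
have up0 n : conv (u n) p = p.
  apply: (conv_limit (u n) u p p up) => e /up [N HN]; exists N => m x Nm.
  by rewrite uD HN//; lia.
have pp : conv p p = p.
  apply: (conv_limit p u p p up) => e /up [N HN]; exists N => m x Nm.
  by rewrite convC up0 subrr normr0; have := HN N x (leqnn N); exact: le_trans.
have ucvg x : u n x @[n --> \oo] --> p x.
  apply/cvgrPdistC_le => e /up [N HN]; near=> n; apply: HN; near: n; by exists N.
exists p, l; split => //.
- split=> // x; apply: (@cvg_unique _ _ (u n x @[n --> \oo])) => //; last exact: ucvg.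
  by have := ucvg (- x); under eq_fun do rewrite u_even.
- by apply: (@cvgr_to_ge _ _ _ R (fun n => u n 0) (p 0) 1 (ucvg 0)); apply: nearW => n; rewrite u0.
- by rewrite -uS up0.
Unshelve. all: end_near. Qed.

End iterate.

(** * Uniqueness of Fourier coefficients *)

(** Minimality is tested on even functions only: the projection attached to a pair of conjugate
    characters has the range spanned by their real and imaginary parts, and its even part is a
    line. *)
Definition rank_one (q : cfun) := forall v, even_cfun v -> conv q v = v ->
  exists c, v = cscale c q.

(** If no smaller idempotent exists, the power method applied to an even w fixed by p can only
    return p, so the square of w is a multiple of p. Using this for v and for p + v and expanding
    the square of p + v shows that v itself is a multiple of p. *)
Lemma idem_below (p : cfun) : idem p -> (exists x, p x != 0) -> ~ rank_one p ->
  exists p', [/\ idem p', exists x, p' x != 0, conv p p' = p' & p' != p :> (G -> R)].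
Proof.
move=> ip [x0 px0] nr; apply: contrapT => H; apply: nr => v ev pv.
have K w : even_cfun w -> conv p w = w -> exists l, conv w w = cscale l p.
  move=> ew pw.
  have [wN|w0] := pselect (exists x, w x != 0); last first.
    have w0' : w = cscale 0 p.
      apply: cfunP => x; rewrite cscaleE mul0r; apply/eqP/negPn/negP => wx.
      by apply: w0; exists x.
    by exists 0; rewrite {2}w0' convZr; apply: cfunP => x; rewrite !cscaleE !mul0r.
  have [p' [l [l0 ip' p'0 wp']]] := power_method w ew wN.
  have pp' : conv p p' = p'.
    have -> : p' = cscale l^-1 (conv (conv w w) p').
      by rewrite wp'; apply: cfunP => x; rewrite !cscaleE mulKf// lt0r_neq0.
    by rewrite convZr -!convA (convA p) pw.
  have [p'p|p'p] := eqVneq (p' : G -> R) p.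
    have {}p'p : p' = p by apply: cfunP => x; rewrite p'p.
    by exists l; rewrite -p'p -wp' p'p -convA (convC w p) pw.
  exfalso; apply: H; exists p'; split => //.
  by exists 0; rewrite gt_eqF// (lt_le_trans ltr01).
have [ep pp] := ip.
have [l vv] := K v ev pv.
have epv : even_cfun (cadd p v) by move=> x; rewrite !caddE ep ev.
have ppv : conv p (cadd p v) = cadd p v by rewrite convDr pp pv.
have [l' ww] := K _ epv ppv.
exists ((l' - l - 1) / 2); apply: cfunP => x.
have := congr1 (fun f : cfun => f x) ww.
rewrite convDl !convDr pp pv (convC v p) pv vv !caddE !cscaleE => E.
by rewrite mulrAC !mulrBl mul1r -E; field.
Qed.

(** Descent on the trace: p - p' is a nonzero idempotent, so its value at 0 is at least 1 and p' 0
    <= p 0 - 1. *)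
Lemma exists_rank_one n (p : cfun) : idem p -> (exists x, p x != 0) -> p 0 < n%:R ->
  exists q, [/\ idem q, exists x, q x != 0, conv p q = q & rank_one q].
Proof.
elim: n p => [|n IH] p ip pN pn.
  have [x px] := pN.
  by have := idem0_ge1 p x ip px; rewrite leNgt (lt_trans pn ltr01).
have [rp|nrp] := pselect (rank_one p).
  by exists p; split => //; case: ip.
have [p' [ip' p'N pp' p'p]] := idem_below p ip pN nrp.
have [ep ipp] := ip; have [ep' ipp'] := ip'.
pose e := csub p p'.
have ie : idem e.
  split; first by move=> x; rewrite !csubE ep ep'.
  rewrite /e /csub convDl !convDr !convZr !convZl ?convZr ipp pp' (convC p' p) pp' ipp'.
  by apply: cfunP => x; rewrite !caddE !cscaleE; ring.
have [x ex] : exists x, e x != 0.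
  apply: contrapT => eN; move/eqP: p'p; apply; apply/funext => x.
  apply/eqP; rewrite eq_sym -subr_eq0 -csubE; apply/negPn/negP => ex.
  by apply: eN; exists x.
have := idem0_ge1 e x ie ex; rewrite csubE => e1.
have [|q [iq qN p'q rq]] := IH p' ip' p'N; first by move: pn; rewrite -natr1; lra.
exists q; split => //.
by rewrite -p'q convA pp'.
Qed.

(* cshift a q + cshift (- a) q is even and fixed by convolution with q, hence a
   multiple of q; evaluating at 0 identifies the factor. *)
Lemma rank_one_dalembert (q : cfun) : idem q -> (exists x, q x != 0) -> rank_one q ->
  forall a x, q (x + a) + q (x - a) = 2 * (q a / q 0) * q x.
Proof.
move=> iq [x0 qx0] rq a x; have [eq0 qq] := iq.
have q1 := idem0_ge1 q x0 iq qx0.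
have q0N : q 0 != 0 by rewrite gt_eqF// (lt_le_trans ltr01).
have [||c vc] := rq (cadd (cshift a q) (cshift (- a) q)).
- move=> y; rewrite !caddE !cshiftE addrC; congr (_ + _); rewrite -eq0; congr (q _);
  by rewrite opprD ?opprK.
- by rewrite convDr !conv_shiftr qq.
have E y : q (y + a) + q (y - a) = c * q y by rewrite -cscaleE -vc.
rewrite E; congr (_ * _).
have := E 0; rewrite !add0r eq0 => E0.
by apply: (mulIf q0N); rewrite -E0; field.
Qed.

(** The sine is recovered from 2 sin x sin a = cos (x - a) - cos (x + a), at a point a with c a ^+ 2
    != 1 and with sqrt (1 - c a ^+ 2) in the role of sin a. If there is no such a, then c is a
    character with values 1 and -1, and d = 0. The explicit form of d makes it continuous when c
    is. *)
Lemma dalembert_character (c : G -> R) : c 0 = 1 -> (forall x, c (- x) = c x) ->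
  (forall x, `|c x| <= 1) -> (forall x y, c (x + y) + c (x - y) = 2 * c x * c y) ->
  exists a k, let d := fun x => k * (c (x - a) - c (x + a)) in
  [/\ forall x, c x ^+ 2 + d x ^+ 2 = 1,
      forall x y, c (x + y) = c x * c y - d x * d y &
      forall x y, d (x + y) = d x * c y + c x * d y].
Proof.
move=> c0 ce c1 cD.
have c2 x : c (x + x) = 2 * c x ^+ 2 - 1.
  by have := cD x x; rewrite subrr c0 expr2; lra.
have cN x y : c (x - y) = c (y - x) by rewrite -ce opprB.
have cprod x y : c (x + y) * c (x - y) = c x ^+ 2 + c y ^+ 2 - 1.
  have := cD (x + y) (x - y).
  by rewrite addrACA subrr addr0 opprB (addrC x) addrACA subrr addr0 !c2; lra.
have cdiff x y : (c (x + y) - c (x - y)) ^+ 2 = 4 * (1 - c x ^+ 2) * (1 - c y ^+ 2).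
  have -> : (c (x + y) - c (x - y)) ^+ 2 =
    (c (x + y) + c (x - y)) ^+ 2 - 4 * (c (x + y) * c (x - y)) by ring.
  by rewrite cprod cD; ring.
have [[a ca]|H] := pselect (exists a, c a ^+ 2 != 1); last first.
  have H1 x : c x ^+ 2 = 1 by apply/eqP/negPn/negP => cx; apply: H; exists x.
  exists 0, 0 => /=; split => [x|x y|x y]; rewrite ?mul0r.
  - by rewrite H1; ring.
  - rewrite subr0.
    have /eqP : (c (x + y) - c (x - y)) ^+ 2 = 0 by rewrite cdiff !H1; ring.
    rewrite sqrf_eq0 subr_eq0 => /eqP E.
    by have := cD x y; rewrite -E; lra.
  - by ring.
have s0 : 0 < 1 - c a ^+ 2.
  rewrite subr_gt0 lt_def eq_sym ca /= -real_normK ?num_real//.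
  by rewrite expr_le1.
pose r := Num.sqrt (1 - c a ^+ 2).
have r0 : r != 0 by rewrite gt_eqF// sqrtr_gt0.
have r2 : r ^+ 2 = 1 - c a ^+ 2 by rewrite sqr_sqrtr// ltW.
exists a, (2 * r)^-1 => d.
have dd x y : d x * d y = - (c (x + y) - c (x - y)) / 2.
  have -> : d x * d y = ((c (x - a) * c (y - a) + c (x + a) * c (y + a))
      - (c (x - a) * c (y + a) + c (x + a) * c (y - a))) / (4 * r ^+ 2).
    by rewrite /d; field.
  have A1 : 2 * (c (x - a) * c (y - a)) = c (x + y - (a + a)) + c (x - y).
    rewrite mulrA -cD; congr (c _ + c _); [by rewrite addrACA -opprD|by rewrite opprB addrA subrK].
  have A2 : 2 * (c (x + a) * c (y + a)) = c (x + y + (a + a)) + c (x - y).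
    rewrite mulrA -cD; congr (c _ + c _); [by rewrite addrACA|by rewrite opprD addrACA subrr addr0].
  have A3 : 2 * (c (x - a) * c (y + a)) = c (x + y) + c (x - y - (a + a)).
    rewrite mulrA -cD; congr (c _ + c _); [by rewrite addrACA addNr addr0|by rewrite opprD addrACA -opprD].
  have A4 : 2 * (c (x + a) * c (y - a)) = c (x + y) + c (x - y + (a + a)).
    rewrite mulrA -cD; congr (c _ + c _); [by rewrite addrACA subrr addr0|by rewrite opprD opprK addrACA].
  have B1 := cD (x + y) (a + a); have B2 := cD (x - y) (a + a).
  rewrite c2 in B1 B2.
  have -> : c (x - a) * c (y - a) + c (x + a) * c (y + a)
      - (c (x - a) * c (y + a) + c (x + a) * c (y - a)) =
      - 2 * r ^+ 2 * (c (x + y) - c (x - y)).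
    rewrite r2; set X1 := c (x - a) * _ in A1 *; set X2 := c (x + a) * c (y + a) in A2 *.
    set X3 := c (x - a) * c (y + a) in A3 *; set X4 := c (x + a) * c (y - a) in A4 *.
    nra.
  by field.
have cDD x y : c (x + y) = c x * c y - d x * d y.
  by rewrite dd; have := cD x y; lra.
split => // [x|x y].
  by rewrite expr2 [d x ^+ 2]expr2 dd subrr c0 c2; field.
rewrite /d.
have E1 := cD x (y - a); have E2 := cD x (y + a); have E3 := cD y (x - a).
have E4 := cD y (x + a).
have F1 : x + (y - a) = x + y - a by rewrite addrA.
have F2 : x + (y + a) = x + y + a by rewrite addrA.
have F3 : y + (x - a) = x + y - a by rewrite addrA (addrC y).
have F4 : y + (x + a) = x + y + a by rewrite addrA (addrC y).
have F5 : y - (x - a) = - (x - (y + a)) by rewrite !opprB addrA addrAC.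
have F6 : y - (x + a) = - (x - (y - a)) by rewrite opprB opprD addrA addrAC.
rewrite F1 in E1; rewrite F2 in E2; rewrite F3 F5 ce in E3; rewrite F4 F6 ce in E4.
have -> : c (x + y - a) - c (x + y + a) =
  (c x * c (y - a) - c x * c (y + a)) + (c y * c (x - a) - c y * c (x + a)) by lra.
by ring.
Qed.

(** The autocorrelation s of f is even and s 0 is the squared norm of f. A minimal idempotent q
    below a top spectral projection of s conv s, divided by q 0, is the real part c of a character.
    If f were orthogonal to c and d, then c conv f would vanish; but l q has f as a convolution
    factor, so l q = l q conv q would vanish at 0. *)
Lemma character_separation (f : cfun) : (exists x, f x != 0) ->
  exists c d : cfun, [/\ forall x, c x ^+ 2 + d x ^+ 2 = 1,
    forall x y, c (x + y) = c x * c y - d x * d y,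
    forall x y, d (x + y) = d x * c y + c x * d y &
    inner f c != 0 \/ inner f d != 0].
Proof.
move=> [x0 fx0].
pose s := conv f (cflip f).
have s_even : even_cfun s.
  move=> x; rewrite !convE -[LHS](mean_shift (- x)).
    by apply: eq_mean => y /=; rewrite opprB addKr mulrC.
  exact: conv_slice_cont.
have s0 : s 0 != 0.
  rewrite gt_eqF// (_ : s 0 = inner (cflip f) (cflip f)).
    by apply: (inner_gt0 _ (- x0)); rewrite /= opprK.
  by rewrite convE; apply: eq_mean => y /=; rewrite add0r.
have sE : s = conv f (cflip f) by [].
clearbody s.
have [p [l [l0 ip p1 sp]]] := power_method s s_even (ex_intro _ 0 s0).
have pN : exists x, p x != 0 by exists 0; rewrite gt_eqF// (lt_le_trans ltr01).
have [q [iq [x1 qx1] pq rq]] : exists q, [/\ idem q, exists x, q x != 0, conv p q = q & rank_one q].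
  apply: (exists_rank_one (Num.truncn (p 0)).+1) => //.
  by have /andP[] := truncn_itv (le_trans ler01 p1).
have q1 := idem0_ge1 q x1 iq qx1; have [qe qq] := iq.
have q0 : 0 < q 0 := lt_le_trans ltr01 q1.
have q0N : q 0 != 0 by rewrite gt_eqF.
pose c := cscale (q 0)^-1 q.
have cE x : c x = q x / q 0 by rewrite cscaleE mulrC.
have qc : q = cscale (q 0) c by apply: cfunP => x; rewrite !cscaleE mulVKf.
have c0 : c 0 = 1 by rewrite cE divff.
have ce x : c (- x) = c x by rewrite !cE qe.
have c1 x : `|c x| <= 1.
  rewrite cE normrM normfV (gtr0_norm q0) ler_pdivrMr// mul1r.
  rewrite -(@ler_pXn2r _ 2)// ?nnegrE ?(ltW q0)// real_normK ?num_real//.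
  rewrite -{1}qq (le_trans (conv_le _ _ _))// expr2.
  by rewrite (_ : inner q q = q 0)// -{3}qq conv0.
have cD x y : c (x + y) + c (x - y) = 2 * c x * c y.
  have := rank_one_dalembert q iq (ex_intro _ x1 qx1) rq y x.
  by rewrite !cE -mulrDl => ->; field.
have [a [k [dc cDD dD]]] := dalembert_character c c0 ce c1 cD.
pose d := cscale k (csub (cshift (- a) c) (cshift a c)).
have dE x : d x = k * (c (x - a) - c (x + a)) by rewrite cscaleE csubE !cshiftE.
exists c, d; split => [x|x y|x y|].
- by rewrite dE dc.
- by rewrite !dE cDD.
- by rewrite !dE dD.
have dN x : d (- x) = - d x.
  rewrite !dE -ce opprD !opprK -[c (- x + a)]ce opprD opprK.
  by ring.
apply/orP; rewrite -negb_and; apply/negP => /andP[/eqP fc /eqP fd].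
have cf0 x : conv c f x = 0.
  rewrite convE.
  transitivity (c x * inner f c + d x * inner f d); last by rewrite fc fd !mulr0 addr0.
  rewrite /inner -!meanZ -?meanD.
  - apply: eq_mean => y; rewrite cDD -!dE dN ce; ring.
  - exact: (cfun_cont (cscale (c x) (CFun _ (inner_cont f c)))).
  - exact: (cfun_cont (cscale (d x) (CFun _ (inner_cont f d)))).
  - exact: inner_cont.
  - exact: inner_cont.
have z0 (g h : cfun) : (forall x, g x = 0) -> forall x, conv g h x = 0.
  move=> g0 x; rewrite convE -[RHS](mean_cst 0).
  by apply: eq_mean => y; rewrite g0 mul0r.
have spq : cscale l q = conv f (conv (cflip f) (conv (conv s p) q)).
  by rewrite !convA -sE sp convZl pq.
have : l * q 0 = 0.
  rewrite -cscaleE -{1}qq -convZr spq convA {1}qc convZl convZl cscaleE z0 ?mulr0//.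
by move/eqP; rewrite mulf_eq0 (negPf q0N) gt_eqF.
Qed.

(** * Derivatives along theta *)

Variable theta : {additive R -> G}.
Hypothesis theta_cont : continuous theta.

(** c + i d is an element chi of the dual of G, and w is its frequency [xi theta chi]. *)
Definition is_character (c d : cfun) (w : R) := [/\ forall x, c x ^+ 2 + d x ^+ 2 = 1,
  forall x y, c (x + y) = c x * c y - d x * d y,
  forall x y, d (x + y) = d x * c y + c x * d y &
  forall t, c (theta t) = cos (w * t) /\ d (theta t) = sin (w * t)].

Definition spectrum_below (f : cfun) (B : R) := forall c d w, is_character c d w ->
  B < `|w| -> inner f c = 0 /\ inner f d = 0.

Lemma character_le1 c d w x : is_character c d w -> `|c x| <= 1 /\ `|d x| <= 1.
Proof.
move=> [n1 _ _ _]; have := n1 x => E.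
by split; rewrite -(@ler_pXn2r _ 2)// ?nnegrE// expr1n real_normK ?num_real// -E;
  rewrite ?lerDl ?lerDr sqr_ge0.
Qed.

Lemma fourier_uniqueness (f : cfun) :
  (forall c d w, is_character c d w -> inner f c = 0 /\ inner f d = 0) ->
  forall x, f x = 0.
Proof.
move=> H x; apply/eqP/negPn/negP => fx.
have [c [d [n1 cD dD nz]]] := character_separation f (ex_intro _ x fx).
have [||||w wP] := real_character (fun t => c (theta t)) (fun t => d (theta t))
  _ _ (fun t => n1 (theta t)).
- by apply: cfun_comp.
- by apply: cfun_comp.
- by move=> s t; rewrite raddfD.
- by move=> s t; rewrite raddfD.
have [z1 z2] := H c d w (And4 n1 cD dD wP).
by case: nz; rewrite ?z1 ?z2 eqxx.
Qed.

Lemma inner_cshift (a : G) (f g : cfun) : inner (cshift a f) g = inner f (cshift (- a) g).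
Proof.
rewrite /inner -[RHS](mean_shift a); last exact: inner_cont.
by apply: eq_mean => x; rewrite !cshiftE addrK.
Qed.

Lemma inner_translate c d w (f : cfun) t : is_character c d w ->
  inner (cshift (theta t) f) c = inner f c * cos (w * t) + inner f d * sin (w * t) /\
  inner (cshift (theta t) f) d = inner f d * cos (w * t) - inner f c * sin (w * t).
Proof.
move=> [n1 cD dD cdt]; have [c1 d1] := cdt (- t).
rewrite mulrN cosN in c1; rewrite mulrN sinN in d1.
rewrite !inner_cshift -!raddfN; split.
  have -> : cshift (theta (- t)) c = cadd (cscale (cos (w * t)) c) (cscale (sin (w * t)) d).
    by apply: cfunP => x; rewrite cshiftE cD c1 d1 caddE !cscaleE; ring.
  by rewrite innerDr !innerZr; ring.
have -> : cshift (theta (- t)) d = cadd (cscale (cos (w * t)) d) (cscale (- sin (w * t)) c).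
  by apply: cfunP => x; rewrite cshiftE dD c1 d1 caddE !cscaleE; ring.
by rewrite innerDr !innerZr; ring.
Qed.

Lemma inner_limit (u : nat -> cfun) (p c : cfun) :
  (forall x, `|c x| <= 1) ->
  (forall e, 0 < e -> exists N, forall n x, (N <= n)%N -> `|u n x - p x| <= e) ->
  inner (u n) c @[n --> \oo] --> inner p c.
Proof.
move=> c1 up; apply/cvgrPdist_le => e e0; have [N HN] := up e e0.
exists N => // n /= Nn; rewrite distrC.
have -> : inner (u n) c - inner p c = inner (csub (u n) p) c.
  by rewrite innerDl innerZl mulN1r.
apply: mean_norm => [|x]; first exact: inner_cont.
by rewrite normrM csubE -[e]mulr1 ler_pM// HN.
Qed.

Fixpoint csum (u : nat -> cfun) (n : nat) : cfun :=
  if n is m.+1 then cadd (csum u m) (u m) else cscale 0 (u 0%N).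

Lemma csumE u n x : csum u n x = \sum_(k < n) u k x.
Proof.
elim: n => [|n IH]; first by rewrite big_ord0 cscaleE mul0r.
by rewrite big_ord_recr/= -IH.
Qed.

Lemma inner_csum u n g : inner (csum u n) g = \sum_(k < n) inner (u k) g.
Proof.
elim: n => [|n IH]; first by rewrite big_ord0 innerZl mul0r.
by rewrite big_ord_recr/= innerDl IH.
Qed.

(** Weierstrass M-test. *)
Lemma csum_limit (u : nat -> cfun) (a : nat -> R) :
  (forall n x, `|u n x| <= a n) -> cvgn (series a) ->
  exists p : cfun, forall e, 0 < e -> exists N, forall n x, (N <= n)%N -> `|csum u n x - p x| <= e.
Proof.
move=> ua ca; apply: uniform_limit => e e0.
have e20 : 0 < e / 2 by rewrite divr_gt0.
have a0 n : 0 <= a n by apply: le_trans (ua n 0).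
have /cvgrPdist_le/(_ _ e20) [N _ HN] := ca.
have H n m x : (n <= m)%N -> `|csum u m x - csum u n x| <= series a m - series a n.
  elim: m => [|m IH]; first by rewrite leqn0 => /eqP ->; rewrite !subrr normr0.
  rewrite leq_eqVlt => /predU1P[->|]; first by rewrite !subrr normr0.
  rewrite ltnS => nm; rewrite /= -/(csum u n) seriesEord/= big_ord_recr/= -/(series a m).
  have := IH nm; rewrite seriesEord/= => {}IH.
  by rewrite addrAC [leRHS]addrAC (le_trans (ler_normD _ _))// lerD.
exists N => n m x Nn Nm.
wlog nm : n m Nn Nm / (n <= m)%N.
  by move=> W; case: (leqP n m) => [|/ltnW] nm; [exact: W|rewrite distrC; exact: W].
rewrite distrC (le_trans (H _ _ _ nm))// (splitr e).
have h1 := HN _ Nn; have h2 := HN _ Nm; rewrite /= in h1 h2.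
by move: h1 h2; rewrite !ler_norml => /andP[? ?] /andP[? ?]; lra.
Qed.

(* 2 L delta D f is the sum over k of
   (-1)^k / (2k+1)^2 (f(. + theta((2k+1) delta)) - f(. - theta((2k+1) delta))).
   By triangle_wave its multiplier is 2 L delta i w when |w| delta <= 1/2. *)
Lemma derivation_exists (B : R) : 0 <= B -> exists (A : R) (D : cfun -> cfun), [/\ 0 < A,
  forall (f : cfun) (M : R), (forall x, `|f x| <= M) -> forall x, `|D f x| <= A * M,
  forall f c d w, is_character c d w -> `|w| <= B ->
    inner (D f) c = w * inner f d /\ inner (D f) d = - w * inner f c &
  forall f, spectrum_below f B -> spectrum_below (D f) B].
Proof.
move=> B0; have [L LN HL] := @triangle_wave R.
(* |w| <= B gives |w dl| <= 1/2, the range of [triangle_wave]; B + 1 avoids a division by 0. *)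
pose dl : R := 1 / (2 * (B + 1)).
have dl0 : 0 < dl by rewrite divr_gt0//; lra.
pose u (f : cfun) k : cfun := cscale (wave_coef k) (csub (cshift (theta (odd_nat k * dl)) f)
  (cshift (theta (- (odd_nat k * dl))) f)).
have uB (f : cfun) (M : R) (fM : forall x, `|f x| <= M) k (x : G) : `|u f k x| <= 2 * M * `|wave_coef k|.
  rewrite /u cscaleE csubE !cshiftE normrM mulrC ler_wpM2r//.
  by rewrite (le_trans (ler_normB _ _))// mulrDl mul1r lerD.
have cW : cvgn (series (fun k => `|wave_coef k : R|)).
  apply: nondecreasing_is_cvgn; first exact: nondecreasing_series.
  by exists (3 / 2 * (odd_nat 0)^-1) => _ [K _ <-]; exact: wave_coef_tail.
have ex (f : cfun) : exists p : cfun, forall e, 0 < e -> exists N, forall n x, (N <= n)%N ->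
    `|csum (u f) n x - p x| <= e.
  have [M M0 fM] := continuous_bound f (cfun_cont f).
  apply: (csum_limit _ (fun k => 2 * M * `|wave_coef k|)); first exact: uB.
  rewrite (_ : series _ = fun n => 2 * M * series (fun k => `|wave_coef k : R|) n).
    exact: is_cvgMr.
  by apply/funext => n; rewrite /series/= mulr_sumr.
have [P HP] := choice ex.
have L0 : 0 < `|L| by rewrite normr_gt0.
pose D (f : cfun) : cfun := cscale (2 * L * dl)^-1 (P f).
have inner_u f c d w : is_character c d w ->
    (forall K, inner (csum (u f) K) c = 2 * inner f d * wave_sum K (w * dl)) /\
    (forall K, inner (csum (u f) K) d = - 2 * inner f c * wave_sum K (w * dl)).
  move=> cd; split=> K; rewrite inner_csum /wave_sum mulr_sumr; apply: eq_bigr => k _;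
  have [E1 E2] := inner_translate c d w f (odd_nat k * dl) cd;
  have [E3 E4] := inner_translate c d w f (- (odd_nat k * dl)) cd;
  rewrite mulrN cosN sinN in E3 E4;
  rewrite /u innerZl /csub innerDl innerZl ?E1 ?E2 ?E3 ?E4;
  rewrite (_ : odd_nat k * (w * dl) = w * (odd_nat k * dl)); by ring.
have HPc f c d w : is_character c d w -> inner (csum (u f) n) c @[n --> \oo] --> inner (P f) c
    /\ inner (csum (u f) n) d @[n --> \oo] --> inner (P f) d.
  move=> cd; split; apply: (inner_limit _ _ _ _ (HP f)) => x; by have [] := character_le1 c d w x cd.
(* The coefficients have absolute sum at most 3/2 and each multiplies a difference of two
   translates, whence 3; the denominator is the normalization of D. *)
exists (3 / (2 * `|L| * dl)), D; split.
- by apply: divr_gt0 => //; apply: mulr_gt0 => //; apply: mulr_gt0.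
- move=> f M fM x.
  have E : `|(2 * L * dl)^-1| = (2 * `|L| * dl)^-1.
    by rewrite normfV 2!normrM (gtr0_norm dl0) ger0_norm.
  rewrite /D cscaleE normrM E [leRHS]mulrAC [leRHS]mulrC ler_wpM2l//.
    by rewrite invr_ge0 mulr_ge0 ?(ltW dl0)// mulr_ge0.
  have M0 : 0 <= M by exact: le_trans (fM 0).
  apply/ler_addgt0Pl => e e0; have [N HN] := HP f e e0.
  have h := HN N x (leqnn N).
  have h2 : `|csum (u f) N x| <= 3 * M.
    rewrite csumE (le_trans (ler_norm_sum _ _ _))//.
    apply: (@le_trans _ _ (\sum_(k < N) 2 * M * `|wave_coef k|)).
      by apply: ler_sum => k _; exact: uB.
    rewrite -mulr_sumr.
    have := @wave_coef_tail R 0 N (leq0n _); rewrite big_mkord.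
    have -> : odd_nat 0 = 1 :> R by [].
    by rewrite invr1; nra.
  have -> : P f x = csum (u f) N x - (csum (u f) N x - P f x) by ring.
  by rewrite (le_trans (ler_normB _ _))// addrC lerD.
- move=> f c d w cd wB.
  have wd : `|w * dl| <= 1 / 2.
    rewrite normrM (ger0_norm (ltW dl0)) /dl mulrA mulr1 ler_pdivrMr; last by lra.
    by lra.
  have [U1 U2] := inner_u f c d w cd; have [V1 V2] := HPc f c d w cd.
  have W := HL _ wd.
  have dN : dl != 0 by rewrite gt_eqF.
  split; rewrite /D innerZl.
    have -> : inner (P f) c = 2 * inner f d * (L * (w * dl)).
      rewrite (funext U1) in V1; apply: (cvg_unique _ V1) => //.
      exact: cvgMr.
    by field; rewrite dN LN.
  have -> : inner (P f) d = - 2 * inner f c * (L * (w * dl)).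
    rewrite (funext U2) in V2; apply: (cvg_unique _ V2) => //.
    exact: cvgMr.
  by field; rewrite dN LN.
- move=> f fB c d w cd wB; have [z1 z2] := fB c d w cd wB.
  have [U1 U2] := inner_u f c d w cd; have [V1 V2] := HPc f c d w cd.
  rewrite /D !innerZl.
  have -> : inner (P f) c = 0.
    have Z n : inner (csum (u f) n) c = 0 by rewrite U1 z2 mulr0 mul0r.
    by rewrite (funext Z) in V1; apply: (cvg_unique _ V1) => //; exact: cvg_cst.
  have -> : inner (P f) d = 0.
    have Z n : inner (csum (u f) n) d = 0 by rewrite U2 z1 mulr0 mul0r.
    by rewrite (funext Z) in V2; apply: (cvg_unique _ V2) => //; exact: cvg_cst.
  by rewrite !mulr0.
Qed.

Lemma exp_partial_le (x : R) n : 0 <= x -> series (exp_coeff x) n <= expR x.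
Proof.
move=> x0; apply: nondecreasing_cvgn_le; last exact: is_cvg_series_exp_coeff.
by apply: nondecreasing_series => k _ _; exact: exp_coeff_ge0.
Qed.

Section derivation.
Variables (B A : R) (D : cfun -> cfun).
Hypothesis A0 : 0 < A.
Hypothesis D_bound : forall (f : cfun) (M : R), (forall x, `|f x| <= M) -> forall x, `|D f x| <= A * M.
Hypothesis D_fourier : forall f c d w, is_character c d w -> `|w| <= B ->
    inner (D f) c = w * inner f d /\ inner (D f) d = - w * inner f c.
Hypothesis D_spectrum : forall f, spectrum_below f B -> spectrum_below (D f) B.

Let E (f : cfun) (t : R) (n : nat) : cfun := cscale (t ^+ n / n`!%:R) (iter n D f).

Lemma iter_bound (f : cfun) M : (forall x, `|f x| <= M) ->
  forall n x, `|iter n D f x| <= A ^+ n * M.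
Proof.
move=> fM; elim=> [|n IH] x; first by rewrite expr0 mul1r.
by rewrite iterS exprS -mulrA; exact: D_bound.
Qed.

Lemma E_bound (f : cfun) M t : (forall x, `|f x| <= M) ->
  forall n x, `|E f t n x| <= M * exp_coeff (`|t| * A) n.
Proof.
move=> fM n x; rewrite /E cscaleE !normrM normrX normfV (ger0_norm (ler0n _ _)).
have := iter_bound f M fM n x => h.
apply: (le_trans (ler_wpM2l _ h)); first by rewrite divr_ge0// exprn_ge0.
by rewrite /exp_coeff/= exprMn [leLHS](_ : _ = M * (`|t| ^+ n * A ^+ n / n`!%:R))//; ring.
Qed.

(* exp(t D) f and f(. + theta t) have the same Fourier coefficients. *)
Lemma taylor_series (f : cfun) t : spectrum_below f B -> forall e, 0 < e ->
  exists N, forall n x, (N <= n)%N -> `|csum (E f t) n x - f (x + theta t)| <= e.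
Proof.
move=> fB.
have [M M0 fM] := continuous_bound f (cfun_cont f).
have [p Hp] : exists p : cfun, forall e, 0 < e -> exists N, forall n x, (N <= n)%N ->
    `|csum (E f t) n x - p x| <= e.
  apply: (csum_limit _ (fun n => M * exp_coeff (`|t| * A) n)); first exact: E_bound.
  rewrite (_ : series _ = fun n => M * series (exp_coeff (`|t| * A)) n).
    by apply: is_cvgMr; exact: is_cvg_series_exp_coeff.
  by apply/funext => n; rewrite /series/= mulr_sumr.
suff H x : csub (cshift (theta t) f) p x = 0.
  move=> e /Hp [N HN]; exists N => n x Nn.
  by have /eqP := H x; rewrite csubE cshiftE subr_eq0 => /eqP ->; exact: HN.
apply: fourier_uniqueness => c d w cd.
have [T1 T2] := inner_translate c d w f t cd.
have Lc : inner (csum (E f t) n) c @[n --> \oo] --> inner p c.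
  by apply: (inner_limit _ _ _ _ Hp) => y; have [] := character_le1 c d w y cd.
have Ld : inner (csum (E f t) n) d @[n --> \oo] --> inner p d.
  by apply: (inner_limit _ _ _ _ Hp) => y; have [] := character_le1 c d w y cd.
suff [E1 E2] : inner p c = inner (cshift (theta t) f) c /\
    inner p d = inner (cshift (theta t) f) d.
  by rewrite /csub !innerDl !innerZl !mulN1r E1 E2 !subrr.
(* At frequencies beyond B both sides vanish, as D preserves [spectrum_below]; the multiplier of D
   is known only for |w| <= B. *)
case: (leP `|w| B) => wB; last first.
  have Z n : inner (E f t n) c = 0 /\ inner (E f t n) d = 0.
    rewrite /E !innerZl.
    suff /(_ c d w cd wB)[-> ->] : spectrum_below (iter n D f) B by rewrite !mulr0.
    by elim: n => [//|n IH]; exact: D_spectrum.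
  have [z1 z2] := fB c d w cd wB.
  rewrite T1 T2 z1 z2 !mul0r addr0 subr0.
  have Zc n : inner (csum (E f t) n) c = 0.
    by rewrite inner_csum big1// => i _; have [] := Z i.
  have Zd n : inner (csum (E f t) n) d = 0.
    by rewrite inner_csum big1// => i _; have [] := Z i.
  rewrite (funext Zc) in Lc; rewrite (funext Zd) in Ld.
  by split; [apply: (cvg_unique _ Lc)|apply: (cvg_unique _ Ld)] => //; exact: cvg_cst.
(* Two applications of D multiply both coefficients by -w^2; an odd iterate needs one more
   application, which exchanges c and d. This matches the parity split of the cosine and sine
   series. *)
have I n : inner (iter (n.*2) D f) c = (-1) ^+ n * w ^+ n.*2 * inner f c /\
    inner (iter (n.*2) D f) d = (-1) ^+ n * w ^+ n.*2 * inner f d.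
  elim: n => [|n [IH1 IH2]]; first by rewrite !expr0 !mul1r.
  rewrite doubleS !iterS.
  have [-> ->] := D_fourier (D (iter n.*2 D f)) c d w cd wB.
  have [-> ->] := D_fourier (iter n.*2 D f) c d w cd wB.
  by rewrite IH1 IH2 !exprS; split; ring.
have J n : inner (E f t n) c = inner f c * cos_coeff (w * t) n + inner f d * sin_coeff (w * t) n /\
    inner (E f t n) d = inner f d * cos_coeff (w * t) n - inner f c * sin_coeff (w * t) n.
  rewrite /E !innerZl /cos_coeff /sin_coeff /=.
  have [I1 I2] := I n./2.
  case: (boolP (odd n)) => on /=.
    have nE : n = n./2.*2.+1 by rewrite -{1}(odd_double_half n) on.
    have n1 : n.-1./2 = n./2 by rewrite nE /= doubleK uphalf_double.
    rewrite n1 !mul0r !mulr0 exprMn.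
    have -> : iter n D f = D (iter n./2.*2 D f) by rewrite {1}nE.
    have [-> ->] := D_fourier (iter n./2.*2 D f) c d w cd wB.
    have wn : w ^+ n = w * w ^+ n./2.*2 by rewrite {1}nE exprS.
    by rewrite I1 I2 wn; split; ring.
  have nE : n = n./2.*2 by rewrite -{1}(odd_double_half n) (negPf on).
  rewrite -nE in I1 I2.
  by rewrite !mul0r !mulr0 exprMn -exprnP I1 I2; split; ring.
have C1 : cvgn (series (cos_coeff (w * t))) by exact: is_cvg_series_cos_coeff.
have C2 : cvgn (series (sin_coeff (w * t))) by exact: is_cvg_series_sin_coeff.
have L1 : series (cos_coeff (w * t)) @ \oo --> cos (w * t) by rewrite cos.unlock; exact: C1.
have L2 : series (sin_coeff (w * t)) @ \oo --> sin (w * t) by rewrite sin.unlock; exact: C2.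
rewrite T1 T2; split.
  apply: (cvg_unique _ Lc) => //.
  rewrite (_ : (fun n => _) = fun n => inner f c * series (cos_coeff (w * t)) n
      + inner f d * series (sin_coeff (w * t)) n); last first.
    apply/funext => n; rewrite inner_csum /series/= !big_mkord !mulr_sumr -big_split/=.
    by apply: eq_bigr => k _; have [] := J k.
  by apply: cvgD; apply: cvgMr.
apply: (cvg_unique _ Ld) => //.
rewrite (_ : (fun n => _) = fun n => inner f d * series (cos_coeff (w * t)) n
    - inner f c * series (sin_coeff (w * t)) n); last first.
  apply/funext => n; rewrite inner_csum /series/= !big_mkord !mulr_sumr -sumrB/=.
  by apply: eq_bigr => k _; have [] := J k.
by apply: cvgB; apply: cvgMr.
Qed.

(** Factoring t^2 A^2 out of the Taylor tail and using (k+2)! >= k! and |t| <= 1 leaves a partial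
    sum of exp A. The quadratic error shows that D f is the derivative of f along [theta]. *)
Lemma taylor_first_order (f : cfun) M : spectrum_below f B -> (forall x, `|f x| <= M) ->
  forall t x, `|t| <= 1 ->
    `|f (x + theta t) - f x - t * D f x| <= M * A ^+ 2 * expR A * t ^+ 2.
Proof.
move=> fB fM t x t1; apply/ler_addgt0Pl => e e0.
have [N HN] := taylor_series f t fB e e0.
have h := HN (N.+2) x (leqW (leqW (leqnn N))).
have M0 : 0 <= M by exact: le_trans (fM 0).
have S1 : csum (E f t) N.+2 x = f x + t * D f x + \sum_(k < N) E f t k.+2 x.
  have E0 : E f t 0 x = f x by rewrite /E cscaleE expr0 fact0 divr1 mul1r.
  have E1 : E f t 1 x = t * D f x by rewrite /E cscaleE expr1 divr1.
  by rewrite csumE 2!big_ord_recl addrA -E0 -E1.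
have S2 : `|\sum_(k < N) E f t k.+2 x| <= M * A ^+ 2 * expR A * t ^+ 2.
  apply: (le_trans (ler_norm_sum _ _ _)).
  apply: (@le_trans _ _ (\sum_(k < N) M * A ^+ 2 * t ^+ 2 * exp_coeff A k)).
    apply: ler_sum => k _; apply: (le_trans (E_bound f M t fM _ _)).
    have -> : M * A ^+ 2 * t ^+ 2 * exp_coeff A k =
        M * (A ^+ 2 * (`|t| ^+ 2 * (A ^+ k * (k`!%:R)^-1))).
      by rewrite /exp_coeff/= real_normK ?num_real//; ring.
    rewrite ler_wpM2l// /exp_coeff/= exprMn.
    have -> : `|t| ^+ k.+2 * A ^+ k.+2 / (k.+2)`!%:R =
        A ^+ 2 * (`|t| ^+ 2 * (A ^+ k * (`|t| ^+ k / (k.+2)`!%:R))).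
      by rewrite -addn2 !exprD; ring.
    rewrite !ler_wpM2l// ?exprn_ge0 ?(ltW A0)//.
    rewrite -[leRHS]mul1r ler_pM ?exprn_ge0 ?invr_ge0//; first exact: exprn_ile1.
    rewrite lef_pV2 ?posrE ?ltr0n ?fact_gt0// ler_nat !factS mulnA.
    by rewrite leq_pmull.
  rewrite -mulr_sumr.
  have := exp_partial_le A N (ltW A0); rewrite /series/= big_mkord => h3.
  by rewrite [leRHS]mulrAC ler_wpM2l// mulr_ge0 ?sqr_ge0// mulr_ge0 ?sqr_ge0.
have -> : f (x + theta t) - f x - t * D f x =
  \sum_(k < N) E f t k.+2 x - (csum (E f t) N.+2 x - f (x + theta t)) by rewrite S1; ring.
by rewrite (le_trans (ler_normB _ _))// addrC lerD.
Qed.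

End derivation.

Lemma is_derive_quadratic (F : R -> R) (t l C : R) :
  (forall h, `|h| <= 1 -> `|F (t + h) - F t - h * l| <= C * h ^+ 2) -> is_derive t 1 F l.
Proof.
move=> H.
have C0 : 0 <= C.
  by have := H 1; rewrite normr1 lexx expr1n mulr1 => /(_ isT); exact: le_trans.
suff K : h^-1 *: ((F \o shift t) (h *: 1) - F t) @[h --> 0^'] --> l.
  apply: DeriveDef; first by apply/cvg_ex; exists l.
  exact: cvg_lim K.
apply/cvgrPdist_le => e e0; near=> h.
have hN : h != 0 by near: h; exact: nbhs_dnbhs_neq.
have h1 : `|h| <= 1.
  by near: h; apply: dnbhs0_le.
have h2 : `|h| <= e / (C + 1).
  by near: h; apply: dnbhs0_le; rewrite divr_gt0// ltr_wpDl.
have := H h h1; rewrite /= /GRing.scale/= mulr1 (addrC t) => H1.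
have -> : l - h^-1 * (F (h + t) - F t) = - (h^-1 * (F (h + t) - F t - h * l)).
  by field.
rewrite normrN normrM normfV mulrC ler_pdivrMr ?normr_gt0// (le_trans H1)//.
rewrite -real_normK ?num_real// expr2 mulrA ler_wpM2r//.
have C1 : 0 < C + 1 by rewrite ltr_wpDl.
have := h2; rewrite ler_pdivlMr// => h3; have := normr_ge0 h; nra.
Unshelve. all: end_near. Qed.

Lemma bernstein_derivatives (f : cfun) (B : R) : 0 <= B -> spectrum_below f B ->
  exists (F : nat -> cfun) (A M : R), [/\ F 0%N = f, 0 < A, 
    forall n x, `|F n x| <= A ^+ n * M,
    forall n (x : G) (t : R), is_derive t 1 (fun s => F n (x + theta s)) (F n.+1 (x + theta t)) &
    forall x, (forall n, F n x = 0) -> forall t, f (x + theta t) = 0].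
Proof.
move=> B0 fB; have [A [D [A0 Db Df Ds]]] := derivation_exists B B0.
have [M M0 fM] := continuous_bound f (cfun_cont f).
have sB n : spectrum_below (iter n D f) B by elim: n => [//|n IH]; exact: Ds.
have FM := iter_bound A D Db f M fM.
exists (fun n => iter n D f), A, M; split => //.
- move=> n x t.
  apply: (@is_derive_quadratic _ _ _ (A ^+ n * M * A ^+ 2 * expR A)) => h h1.
  rewrite raddfD addrA.
  exact: (taylor_first_order B A D A0 Db Df Ds _ _ (sB n) (FM n)).
- move=> x Fx t; apply/eqP; rewrite -normr_le0; apply/ler_addgt0Pl => e e0; rewrite addr0.
  have [N HN] := taylor_series B A D Db Df Ds f t fB e e0.
  have := HN N x (leqnn N); rewrite csumE big1 ?sub0r ?normrN// => k _.
  by rewrite cscaleE Fx mulr0.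
Qed.

(** * Measure of sublevel sets *)

Hypothesis theta_dense : dense (range theta).

Lemma line_vanishing (u : cfun) (x : G) : (forall t, u (x + theta t) = 0) -> forall y, u y = 0.
Proof.
move=> H y; apply/eqP/negPn/negP => uy.
have oO : open [set z | u (x + z) != 0].
  have cu : continuous (fun z => u (x + z)).
    by apply: cfun_comp => z; have := continuous_shift x z; under eq_fun do rewrite addrC.
  have /continuousP/(_ _ (@open_neq R 0)) := cu.
  by [].
have [|z [/= uz [t _ tz]]] := theta_dense _ _ oO.
  by exists (y - x) => /=; rewrite addrC subrK.
by move: uz; rewrite -tz H eqxx.
Qed.

(** Some derivative of U or V is nonzero at each x, hence bounded below near x; otherwise both
    functions would vanish on a line and so on G. Compactness makes this uniform, and one N serves
    as bound on the order and, through 1 / (N + 1), as lower bound on the value. *)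
Lemma uniform_nonflat (U V : nat -> cfun) :
  (forall x, (forall n, U n x = 0) -> forall t, U 0%N (x + theta t) = 0) ->
  (forall x, (forall n, V n x = 0) -> forall t, V 0%N (x + theta t) = 0) ->
  (exists x, U 0%N x != 0 \/ V 0%N x != 0) ->
  exists N, forall x, exists2 n, (n <= N)%N & N.+1%:R^-1 <= `|U n x| \/ N.+1%:R^-1 <= `|V n x|.
Proof.
move=> HU HV [x0 x0N].
pose P N x := exists2 n, (n <= N)%N & N.+1%:R^-1 <= `|U n x| \/ N.+1%:R^-1 <= `|V n x|.
have /compact_near_coveringP/(_ _ \oo P _) H := cptG.
suff /H [N _ HN] : forall x : G, setT x -> \forall x' \near x & N \near \oo, P N x'.
  by exists N => x; exact: HN N (leqnn N) x I.
move=> x _.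
have loc (W : cfun) n : W x != 0 -> \forall x' \near x & N \near \oo,
    (n <= N)%N /\ N.+1%:R^-1 <= `|W x'|.
  move=> Wx; have a0 : 0 < `|W x| / 2 by rewrite divr_gt0 ?normr_gt0.
  have nx : \forall x' \near x, `|W x| / 2 <= `|W x'|.
    have /cvgrPdist_le/(_ _ a0) := cfun_cont W x; apply: filterS => x' h.
    have := lerB_dist (W x) (W x').
    by move=> h'; lra.
  have nN : \forall N \near \oo, (n <= N)%N /\ N.+1%:R^-1 <= `|W x| / 2.
    exists (maxn n (Num.truncn (`|W x| / 2)^-1)) => // N /=; rewrite geq_max => /andP[nN tN].
    split => //; rewrite invf_ple ?posrE//.
    have ai : 0 <= (`|W x| / 2)^-1 by rewrite invr_ge0 ltW.
    have /andP[_ h] := truncn_itv ai.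
    by rewrite (le_trans (ltW h))// ler_nat ltnS.
  near=> x' N.
  have h1 : `|W x| / 2 <= `|W x'| by near: x'.
  have [h2 h3] : (n <= N)%N /\ N.+1%:R^-1 <= `|W x| / 2 by near: N.
  by split => //; exact: le_trans h1.
have [[n Un]|UN] := pselect (exists n, U n x != 0).
  by apply: filterS (loc (U n) n Un) => -[x' N] [/= nN h]; exists n => //; left.
have [[n Vn]|VN] := pselect (exists n, V n x != 0).
  by apply: filterS (loc (V n) n Vn) => -[x' N] [/= nN h]; exists n => //; right.
exfalso.
have UZ : forall y, U 0%N y = 0.
  apply: (@line_vanishing _ x); apply: HU => n; apply/eqP/negPn/negP => h; apply: UN.
  by exists n.
have VZ : forall y, V 0%N y = 0.
  apply: (@line_vanishing _ x); apply: HV => n; apply/eqP/negPn/negP => h; apply: VN.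
  by exists n.
by case: x0N; rewrite ?UZ ?VZ eqxx.
Unshelve. all: end_near. Qed.

(** The count, integrated over x, is a sum of K measures of translates of E, each equal to
    [mu E]. *)
Lemma average_measure (E : set (borel G)) (K m : nat) (t : nat -> R) : measurable E ->
  (forall x : G, (count (fun j => (x + theta (t j))%R \in (E : set G)) (iota 0 K) <= m)%N) ->
  (K%:R%:E * mu E <= m%:R%:E)%E.
Proof.
move=> mE Hc.
pose Ej j : set (borel G) := [set x : G | (E : set G) (x + theta (t j))].
have mEj j : measurable (Ej j).
  by have := measurable_shift (theta (t j)) measurableT E mE; rewrite setTI.
have muEj j : mu (Ej j) = mu E.
  rewrite -(muT (theta (t j)) _ (mEj j)); congr (mu _); apply/seteqP; split => [x [y]|x Ex].
    by rewrite /Ej/= => Ey <-; rewrite addrC.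
  by exists (x - theta (t j)); rewrite /Ej/= ?subrK// addrC subrK.
have -> : (K%:R%:E * mu E = \int[mu]_x \sum_(j <- iota 0 K) (\1_(Ej j) x)%:E)%E.
  rewrite ge0_integral_sum//; last first.
    by move=> j; apply/measurable_EFinP; exact: measurable_indic.
  transitivity (\sum_(j <- iota 0 K) mu E)%E; last first.
    apply: eq_bigr => j _; apply/esym; rewrite integral_indic// setIT; exact: muEj.
  rewrite -(fineK (fin_num_measure mu _ mE)) sumEFin big_const_seq count_predT size_iota.
  by rewrite iter_addr_0 -EFinM mulr_natl.
apply: (@le_trans _ _ (\int[mu]_(x in [set: borel G]) m%:R%:E)%E); last first.
  rewrite integral_cst// [X in (_ * X)%E](_ : _ = 1%E) ?mule1//; exact: probability_setT.
apply: ge0_le_integral => //.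
- by move=> x _; apply: sume_ge0 => j _; rewrite lee_fin.
- by apply: emeasurable_sum => j; apply/measurable_EFinP; exact: measurable_indic.
- move=> x _; rewrite sumEFin lee_fin.
  have -> : \sum_(j <- iota 0 K) \1_(Ej j) x =
      (count (fun j => ((x : G) + theta (t j)) \in (E : set G)) (iota 0 K))%:R :> R.
    elim: (iota 0 K) => [|j s IH]; first by rewrite big_nil.
    have e : (x \in Ej j) = ((x : G) + theta (t j) \in (E : set G)).
      by apply/idP/idP; rewrite !inE.
    by rewrite big_cons IH indicE e /= natrD.
  by rewrite ler_nat.
Qed.

(** The maximum of |u| and |v| replaces the modulus of u + i v: the set contains the sublevel set of
    the modulus, and the real mean value argument can be run on whichever of u and v has a large
    derivative. *)
Definition sublevel (u v : cfun) (e : R) : set (borel G) := [set x : G | `|u x| <= e /\ `|v x| <= e].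

Lemma measurable_sublevel u v e : measurable (sublevel u v e).
Proof.
have H (w : cfun) : measurable ([set x : G | `|w x| <= e] : set (borel G)).
  rewrite (_ : [set x : G | _] = ~` [set x : G | e < `|w x|]).
    apply: measurableC; apply: borel_open.
    have cw : continuous (fun x => `|w x|) by move=> x; apply: cvg_norm; exact: cfun_cont.
    by have /continuousP/(_ _ (@open_gt R e)) := cw.
  by apply/seteqP; split => x /=; rewrite leNgt => /negP.
rewrite (_ : sublevel u v e = [set x : G | `|u x| <= e] `&` [set x : G | `|v x| <= e])//.
exact: measurableI.
Qed.

(** The next derivative is bounded by A'^(N+1) M', so over a length dl the n-th one moves by at most
    c / 2. The constants A' and M' are common to all n <= N and to both functions the lemma is
    applied to. *)
Lemma persistent_derivative (F : nat -> cfun) (A M A' M' c dl : R) N n x :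
  0 < A -> A <= A' -> 1 <= A' -> M <= M' -> 0 < dl -> dl <= 1 ->
  (forall n x, `|F n x| <= A ^+ n * M) ->
  (forall n (x : G) (t : R), is_derive t 1 (fun s => F n (x + theta s)) (F n.+1 (x + theta t))) ->
  (n <= N)%N -> A' ^+ N.+1 * M' * dl <= c / 2 -> c <= `|F n x| ->
  forall t, 0 <= t <= dl -> c / 2 <= `|F n (x + theta t)|.
Proof.
move=> A0 AA' A1 MM' dl0 dl1 FM FD nN dlc cF t /andP[t0 td].
have M0 : 0 <= M by have := FM 0%N x; rewrite expr0 mul1r; exact: le_trans.
have A'0 : 0 <= A' by exact: le_trans A1.
have FB y : `|F n.+1 y| <= A' ^+ N.+1 * M'.
  apply: (le_trans (FM _ _)); rewrite ler_pM ?exprn_ge0 ?(ltW A0)//.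
  apply: (@le_trans _ _ (A' ^+ n.+1)); first by rewrite lerXn2r ?nnegrE ?(ltW A0).
  by rewrite ler_weXn2l.
have z1 : `|0 : R| <= 1 by rewrite normr0.
have t1 : `|t| <= 1 by rewrite ger0_norm// (le_trans td).
have := mvt_bound (fun s => F n (x + theta s)) (fun s => F n.+1 (x + theta s)) 1 (A' ^+ N.+1 * M')
  (fun s _ => FD n x s) (fun s _ => FB _) 0 t z1 t1.
rewrite raddf0 addr0 subr0 (ger0_norm t0) => H.
have H2 : `|F n (x + theta t) - F n x| <= c / 2.
  apply: le_trans dlc; apply: (le_trans H).
  by rewrite ler_wpM2l// mulr_ge0 ?exprn_ge0// (le_trans M0).
by have := lerB_dist (F n x) (F n (x + theta t)); rewrite distrC; lra.
Qed.

Lemma sublevel_measure (u v : cfun) (B : R) : 0 <= B -> spectrum_below u B -> spectrum_below v B ->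
  (exists x, u x != 0 \/ v x != 0) ->
  exists N (c : R), 0 < c /\ forall K, (0 < K)%N ->
    (K%:R%:E * mu (sublevel u v (c / K%:R ^+ N)) <= (2 ^ N)%:R%:E)%E.
Proof.
move=> B0 uB vB uv0.
have [U [AU [MU [U0 AU0 UM UD UZ]]]] := bernstein_derivatives u B B0 uB.
have [V [AV [MV [V0 AV0 VM VD VZ]]]] := bernstein_derivatives v B B0 vB.
rewrite -U0 in UZ; rewrite -V0 in VZ; rewrite -U0 -V0 in uv0.
have [N HN] := uniform_nonflat U V UZ VZ uv0.
have MU0 : 0 <= MU by have := UM 0%N 0; rewrite expr0 mul1r; exact: le_trans.
have MV0 : 0 <= MV by have := VM 0%N 0; rewrite expr0 mul1r; exact: le_trans.
pose A := AU + AV + 1; pose M := MU + MV.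
have A1 : 1 <= A by rewrite /A; lra.
have L0 : 0 <= A ^+ N.+1 * M by rewrite mulr_ge0 ?exprn_ge0 ?addr_ge0//; lra.
pose c0 : R := N.+1%:R^-1; have c00 : 0 < c0 by rewrite invr_gt0.
(* Makes the variation bound [A ^+ N.+1 * M * dl] at most c0 / 2; the added 1 keeps the denominator
   positive. *)
pose dl := Num.min 1 (c0 / 2 / (A ^+ N.+1 * M + 1)).
have q0 : 0 < c0 / 2 / (A ^+ N.+1 * M + 1) by rewrite !divr_gt0//; lra.
have dl0 : 0 < dl by rewrite lt_min ltr01.
have dl1 : dl <= 1 by rewrite ge_min lexx.
have dlc : A ^+ N.+1 * M * dl <= c0 / 2.
  apply: (@le_trans _ _ ((A ^+ N.+1 * M + 1) * dl)); first by rewrite ler_wpM2r ?(ltW dl0)//; lra.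
  by rewrite mulrC -ler_pdivlMr; [rewrite ge_min lexx orbT|lra].
(* With this constant (2 K / dl)^N e is exactly c0 / 4, strictly below the lower bound c0 / 2 of the
   derivative; smaller n only decrease it, since 2 K / dl >= 1. *)
exists N, (c0 / 4 * (dl / 2) ^+ N); split.
  by rewrite mulr_gt0 ?divr_gt0// exprn_gt0// divr_gt0.
move=> K K0; set e := _ / K%:R ^+ N.
have KR : 1 <= K%:R :> R by rewrite ler1n.
have KR0 : 0 < K%:R :> R by rewrite ltr0n.
have e0 : 0 <= e.
  by rewrite /e !mulr_ge0 ?invr_ge0 ?exprn_ge0 ?divr_ge0 ?(ltW c00) ?(ltW dl0) ?(ltW KR0).
have ec n : (n <= N)%N -> (2 * K%:R / dl) ^+ n * e < c0 / 2.
  move=> nN; apply: (@le_lt_trans _ _ ((2 * K%:R / dl) ^+ N * e)).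
    rewrite ler_wpM2r// ler_weXn2l// ler_pdivlMr// mul1r; lra.
  have -> : (2 * K%:R / dl) ^+ N * e = c0 / 4 * (2 * K%:R / dl * (dl / 2) / K%:R) ^+ N.
    rewrite /e [X in _ = _ * X]exprMn [X in _ = _ * (X * _)]exprMn exprVn.
    by set X := (_ / dl) ^+ N; set Y := (dl / 2) ^+ N; set Z := _^-1; ring.
  have -> : 2 * K%:R / dl * (dl / 2) / K%:R = 1 by field; rewrite !gt_eqF.
  by rewrite expr1n; lra.
apply: (@average_measure _ _ _ (fun j => j%:R * (dl / K%:R))); first exact: measurable_sublevel.
move=> x; set P := fun j => _.
have [n nN H] := HN x.
suff h : (count P (iota 0 K) < 2 ^ n)%N by apply: (leq_trans (ltnW h)); rewrite leq_exp2l.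
case: H => H.
- apply: (@count_small_values R n (fun n s => U n (x + theta s)) K dl e (c0 / 2) P K0 dl0).
  + move=> t; apply: (persistent_derivative U AU MU A M c0 dl N n x) => //; rewrite /A /M; lra.
  + exact: ec.
  + by move=> j; rewrite /P inE U0 => -[].
- apply: (@count_small_values R n (fun n s => V n (x + theta s)) K dl e (c0 / 2) P K0 dl0).
  + move=> t; apply: (persistent_derivative V AV MV A M c0 dl N n x) => //; rewrite /A /M; lra.
  + exact: ec.
  + by move=> j; rewrite /P inE V0 => -[].
Qed.

End compact_group.

(** * The complex-valued function *)

Section complex_valued.
Context {R : realType}.

Lemma normcE (z : R[i]) : Normc.normc z = Num.sqrt (complex.Re z ^+ 2 + complex.Im z ^+ 2).
Proof. by case: z. Qed.

Lemma Re_le_normc (z : R[i]) : `|complex.Re z| <= Normc.normc z.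
Proof. by rewrite normcE -sqrtr_sqr ler_wsqrtr// lerDl sqr_ge0. Qed.

Lemma Im_le_normc (z : R[i]) : `|complex.Im z| <= Normc.normc z.
Proof. by rewrite normcE -sqrtr_sqr ler_wsqrtr// lerDr sqr_ge0. Qed.

Lemma continuous_complex (T : topologicalType) (h : T -> R[i]) : continuous h ->
  continuous (fun x => complex.Re (h x)) /\ continuous (fun x => complex.Im (h x)).
Proof.
move=> ch.
have H x (e : R) : 0 < e -> \forall x' \near x, Normc.normc (h x - h x') < e.
  move=> e0; have e0' : 0 < (e%:C)%C by rewrite ltcR.
  have /cvgrPdist_lt/(_ _ e0') := ch x; apply: filterS => x'.
  by rewrite normc_def -/(Normc.normc _) ltcR normcE.
split=> x; apply/cvgrPdist_lt => e /(H x); apply: filterS => x'; apply: le_lt_trans.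
  by apply: le_trans (Re_le_normc _); case: (h x) (h x') => [a b] [c d].
by apply: le_trans (Im_le_normc _); case: (h x) (h x') => [a b] [c d].
Qed.

Lemma complex_continuous (T : topologicalType) (u v : T -> R) : continuous u -> continuous v ->
  continuous (fun x => (u x +i* v x)%C : R[i]).
Proof.
move=> cu cv x; apply/cvgrPdist_lt => -[e e'] /=; rewrite ltcE /= => /andP[/eqP -> e0].
have e20 : 0 < e / 2 by rewrite divr_gt0.
have /cvgrPdist_lt/(_ _ e20) Hu := cu x; have /cvgrPdist_lt/(_ _ e20) Hv := cv x.
near=> x'.
have hu : `|u x - u x'| < e / 2 by near: x'.
have hv : `|v x - v x'| < e / 2 by near: x'.
rewrite normc_def /= -[(e +i* 0)%C]/(e%:C)%C ltcR.
have -> : e = Num.sqrt (e ^+ 2) by rewrite sqrtr_sqr gtr0_norm.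
rewrite ltr_sqrt ?exprn_gt0//.
move: hu hv; rewrite !ltr_norml => /andP[? ?] /andP[? ?]; nra.
Unshelve. all: end_near. Qed.

(** At x = pi / (2 (w - w')) the two phases differ by a right angle. *)
Lemma expi_inj (w w' : R) : (forall x, expi (w * x) = expi (w' * x)) -> w = w'.
Proof.
move=> H; apply/eqP; rewrite -subr_eq0; apply/negPn/negP => ww.
have [E1 E2] : cos (w * (pi / 2 / (w - w'))) = cos (w' * (pi / 2 / (w - w'))) /\
    sin (w * (pi / 2 / (w - w'))) = sin (w' * (pi / 2 / (w - w'))).
  by have [-> ->] := H (pi / 2 / (w - w')).
have : sin (w * (pi / 2 / (w - w')) - w' * (pi / 2 / (w - w'))) = 0.
  by rewrite sinB E1 E2; ring.
rewrite -mulrBl (_ : (w - w') * (pi / 2 / (w - w')) = pi / 2); last by field.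
by rewrite sin_pihalf => /eqP; rewrite oner_eq0.
Qed.

End complex_valued.

(** * From the complex spectrum to real and imaginary parts *)

Section spectrum.
Context {R : realType} {G : topologicalZmodType}.
Variable mu : probability (borel G) R.
Hypothesis cptG : compact [set: G].
Variable theta : {additive R -> G}.
Local Notation cfun := (@cfun R G).
Local Notation inner := (@inner R G mu).
Local Notation spectrum_below := (@spectrum_below R G mu theta).

(** For |w| > B the coefficients of h vanish at chi and at its conjugate, whose frequency is -w. The
    real and imaginary parts of these two equations are four linear relations that make all four
    inner products of u, v with c, d vanish. *)
Lemma spectrum_below_Re_Im (h : G -> R[i]) (B : R) (u v : cfun) :
  (forall x, h x = (u x +i* v x)%C) ->
  (forall chi, spectrum mu h chi -> `|xi theta chi| <= B) ->
  spectrum_below u B /\ spectrum_below v B.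
Proof.
move=> hE hB.
have fourierE (c d : cfun) : fourier mu h (fun x => (c x +i* d x)%C) =
    ((inner u c + inner v d) +i* (inner v c - inner u d))%C.
  rewrite /fourier /Cintegral; congr (_ +i* _)%C.
    rewrite /inner -(meanD mu cptG); [|exact: inner_cont..].
    by apply: eq_mean => x; rewrite hE /=; ring.
  rewrite /inner -(meanB mu cptG); [|exact: inner_cont..].
  by apply: eq_mean => x; rewrite hE /=; ring.
have key (c d : cfun) w : is_character theta c d w -> B < `|w| ->
    inner u c + inner v d = 0 /\ inner v c - inner u d = 0.
  move=> [n1 cD dD cdt] wB.
  suff : fourier mu h (fun x => (c x +i* d x)%C) = 0.
    by rewrite fourierE => -[-> ->].
  apply/eqP/negPn/negP => F0.
  suff chiD : dual (fun x => (c x +i* d x)%C).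
    have := hB _ (conj chiD F0).
    suff -> : xi theta (fun x => (c x +i* d x)%C) = w by rewrite leNgt wB.
    rewrite /xi; case: xgetP => [w' _ /= Hw'|/(_ w) []].
      apply: expi_inj => t; rewrite -Hw' /expi.
      by have [-> ->] := cdt t.
    by move=> t /=; rewrite /expi; have [-> ->] := cdt t.
  split.
  - by apply: complex_continuous; exact: cfun_cont.
  - by move=> x y /=; rewrite cD dD; congr (_ +i* _)%C; ring.
  - by move=> x; rewrite normc_def /= n1 sqrtr1.
have flip (c d : cfun) w : is_character theta c d w -> B < `|w| ->
    inner u c - inner v d = 0 /\ inner v c + inner u d = 0.
  move=> [n1 cD dD cdt] wB.
  have [||E1 E2] := key c (cscale (-1) d) (- w).
  - split=> [x|x y|x y|t]; rewrite !cscaleE.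
    + by rewrite mulN1r sqrrN n1.
    + by rewrite cD; ring.
    + by rewrite dD; ring.
    + by have [-> ->] := cdt t; rewrite mulNr cosN sinN mulN1r.
  - by rewrite normrN.
  by move: E1 E2; rewrite !(innerZr mu cptG) !mulN1r opprK.
by split=> c d w cd wB; have [K1 K2] := key c d w cd wB; have [K3 K4] := flip c d w cd wB; lra.
Qed.

End spectrum.

Theorem mainTheorem2 (R : realType) (G : topologicalZmodType)
    (theta : {additive R -> G}) (mu : probability (borel G) R)
    (h : G -> R[i])
    (Gtheta : compactification theta) (muH : haar mu)
    (h_cont : continuous h) (h_neq0 : ~ (forall x, h x = 0))
    (h_spec : bounded_set (xi theta @` spectrum mu h)) :
  mu.-integrable [set: borel G] (fun x => logminus (Normc.normc (h x)))
  /\ (0 < mahler mu h)%E.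
Proof.
have [cptG _ theta_cont theta_dense] := Gtheta; have [muT _ _] := muH.
have [cu cv] := continuous_complex _ h h_cont.
pose u := CFun _ cu; pose v := CFun _ cv.
have hE x : h x = (u x +i* v x)%C by rewrite /u /v /=; case: (h x).
have [B B0 HB] : exists2 B : R, 0 <= B & forall chi, spectrum mu h chi -> `|xi theta chi| <= B.
  have [M [_ HM]] := h_spec; exists (`|M| + 1); first by rewrite addr_ge0.
  move=> chi Hchi; apply: (HM (`|M| + 1)); last by exists chi.
  by rewrite (le_lt_trans (ler_norm M))// ltrDl.
have [uB vB] := spectrum_below_Re_Im mu cptG theta h B u v hE HB.
have uv0 : exists x, u x != 0 \/ v x != 0.
  apply: contrapT => H; apply: h_neq0 => x; rewrite hE.
  have -> : u x = 0 by apply/eqP/negPn/negP => ux; apply: H; exists x; left.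
  have -> // : v x = 0 by apply/eqP/negPn/negP => vx; apply: H; exists x; right.
have [N [c [c0 Hc]]] := sublevel_measure mu cptG muT theta theta_cont theta_dense u v B B0 uB vB uv0.
have mr : measurable_fun [set: borel G] (fun x : borel G => Normc.normc (h x)).
  apply: continuous_borel.
  have -> : (fun x => Normc.normc (h x)) = (fun x => Num.sqrt (u x ^+ 2 + v x ^+ 2)).
    by apply/funext => x; rewrite normcE.
  move=> x; apply: (@continuous_comp _ _ _ (fun x => u x ^+ 2 + v x ^+ 2) Num.sqrt).
    by apply: cvgD; apply: cvgM; exact: cfun_cont.
  exact: sqrt_continuous.
have iL : mu.-integrable [set: borel G] (fun x => logminus (Normc.normc (h x))).
  suff Hmu K : (0 < K)%N ->
      (K%:R%:E * mu [set x : borel G | (Normc.normc (h x) <= c / K%:R ^+ N)%R] <= (2 ^ N)%:R%:E)%E.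
    exact: (logminus_integrable mu (fun x : borel G => Normc.normc (h x)) mr N c c0 Hmu).
  move=> K0.
  apply: le_trans (Hc K K0); apply: lee_wpmul2l; first by rewrite lee_fin.
  apply: le_measure; rewrite ?inE.
  - by rewrite -[X in measurable X]setTI; exact: measurable_fun_ler.
  - exact: measurable_sublevel.
  - move=> x /= hx; split; apply: le_trans hx.
      by have := Re_le_normc (h x).
    by have := Im_le_normc (h x).
split=> //; rewrite /mahler.
have r0 x : 0 <= Normc.normc (h x) by rewrite normcE sqrtr_ge0.
have := integral_lne_gtNy mu (fun x : borel G => Normc.normc (h x)) iL r0.
(* [expeR] vanishes only at -oo, the value just excluded. *)
by case: (\int[mu]_x _)%E => [s _| _|] //=; rewrite ?lte_fin ?expR_gt0.
Qed.
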